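(* Let $a\in(0,\infty)$, $1\le p\le q<\infty$, $0<\alpha<d$, and let $(u,v)$ be a pair of weights on $\mathbb{R}^d$. If $$(u,v)\in\bigcup_{b'>a}\ \bigcup_{0<\beta'<\alpha}A_{p,q,\beta'}^{b'},$$ then $\tilde I_\alpha^a$ is bounded from $L^p(\mathbb{R}^d,v,\gamma)$ to $L^{q,\infty}(\mathbb{R}^d,u,\gamma)$; that is, there exists a constant $C>0$ such that for all $f\in L^p(\mathbb{R}^d,v,\gamma)$ and all $\lambda>0$, $$\int_{\{x\in\mathbb{R}^d:\,\tilde I_\alpha^a(f)(x)>\lambda\}}u(x)\,d\gamma(x)\le\frac{C}{\lambda^q}\left(\int_{\mathbb{R}^d}|f(x)|^p\,v(x)\,d\gamma(x)\right)^{q/p}.$$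
   Context: $\gamma$ is the Gaussian probability measure on $\mathbb{R}^d$, $d\gamma(x)=\pi^{-d/2}e^{-|x|^2}\,dx$, with $|\cdot|$ the Euclidean norm. A weight is a locally integrable function on $\mathbb{R}^d$ that is nonnegative $\gamma$-almost everywhere. $L^p(\mathbb{R}^d,v,\gamma)$ is the space of (real-valued) measurable $f$ with $\int_{\mathbb{R}^d}|f|^p v\,d\gamma<\infty$. All cubes $Q\subset\mathbb{R}^d$ have sides parallel to the coordinate axes; $c_Q$ is the center and $\ell(Q)$ the side length of $Q$; $Q(x,r)$ denotes the cube with center $x$ and side length $r$. Put $m(x)=\min\{1,1/|x|\}$ (with $m(0)=1$) and $\mathscr{Q}_a=\{Q\subset\mathbb{R}^d \text{ cube}:\ \ell(Q)\le a\,m(c_Q)\}$. The local fractional integral operator with cubes is $$\tilde I_\alpha^a(f)(x)=\int_{Q(x,\,a\,m(x))}\frac{f(y)}{[\gamma(Q(x,|x-y|))]^{1-\alpha/d}}\,d\gamma(y),$$ where at points $x$ at which the integral is not absolutely convergent the value is counted as $+\infty$. The local Muckenhoupt type class, for $a>0$ and $0\le\beta<d$: for $p>1$, with $p'=p/(p-1)$, $(u,v)\in A_{p,q,\beta}^{a}$ means $$\sup_{Q\in\mathscr{Q}_a}\gamma(Q)^{\beta/d+1/q-1/p}\left(\frac1{\gamma(Q)}\int_Q u\,d\gamma\right)^{1/q}\left(\frac1{\gamma(Q)}\int_Q v^{1-p'}\,d\gamma\right)^{1/p'}<\infty .$$ For $p=1$, $(u,v)\in A_{1,q,\beta}^a$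 means $$\sup_{Q\in\mathscr{Q}_a}\ \operatorname*{ess\,sup}_{x\in Q}\ \gamma(Q)^{\beta/d+1/q-1}\left(\frac1{\gamma(Q)}\int_Q u\,d\gamma\right)^{1/q}v(x)^{-1}<\infty,$$ the essential supremum being with respect to $\gamma$. Usual convention: $0\cdot\infty=0$. *)

(* Defs.v *)
From HB Require Import structures.
From mathcomp Require Import all_boot all_order all_algebra.
From mathcomp Require Import all_classical all_reals all_analysis.
From mathcomp Require Import measurable_realfun ess_sup_inf.
Set Implicit Arguments.
Unset Strict Implicit.
Unset Printing Implicit Defensive.
Import Order.TTheory GRing.Theory Num.Theory.
Import numFieldNormedType.Exports.
Local Open Scope classical_set_scope.
Local Open Scope ring_scope.

(* R^d with its Borel sigma-algebra, which is the one the library puts on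
   tuples: it is generated by the coordinate maps. *)
Notation Rd R d := (d.-tuple (measurableTypeR R)).

(* The library has binary product measures only: Lebesgue measure on R^d is
   obtained by iterating them along R^(d+1) = R * R^d. *)
Section lebesgue_Rd.
Context {R : realType}.
Local Open Scope ereal_scope.

Definition consRd (d : nat) (z : measurableTypeR R * Rd R d) : Rd R d.+1 :=
  [tuple of z.1 :: z.2].

Lemma measurable_consRd d : measurable_fun setT (@consRd d).
Proof. exact: measurable_cons. Qed.

Definition unconsRd (d : nat) (t : Rd R d.+1) : measurableTypeR R * Rd R d :=
  (tnth t ord0, [tuple of behead t]).

Lemma measurable_unconsRd d : measurable_fun setT (@unconsRd d).
Proof.
apply/measurable_fun_pairP; split; last exact: measurable_behead.
exact: measurable_tnth.
Qed.

Lemma consRdK d : cancel (@consRd d) (@unconsRd d).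
Proof. by move=> [x t]; congr (_, _); apply/val_inj. Qed.

Lemma unconsRdK d : cancel (@unconsRd d) (@consRd d).
Proof.
move=> t; case/tupleP: t => x t; rewrite /unconsRd /consRd /=.
by apply/val_inj.
Qed.

Definition lebesgueS (d : nat)
    (mu : {sigma_finite_measure set (Rd R d) -> \bar R}) :
    set (Rd R d.+1) -> \bar R :=
  pushforward ((@lebesgue_measure R) \x mu) (@consRd d).

Section lebesgueS_instances.
Variables (d : nat) (mu : {sigma_finite_measure set (Rd R d) -> \bar R}).

Let lebesgueS0 : lebesgueS mu set0 = 0.
Proof. by rewrite /lebesgueS /pushforward preimage_set0 measure0. Qed.

Let lebesgueS_ge0 A : 0 <= lebesgueS mu A.
Proof. by rewrite /lebesgueS /pushforward; apply: measure_ge0. Qed.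

Let lebesgueS_sigma_additive : semi_sigma_additive (lebesgueS mu).
Proof.
move=> F mF tF mUF; rewrite /lebesgueS /pushforward preimage_bigcup.
apply: measure_semi_sigma_additive.
- by move=> n; rewrite -[X in measurable X]setTI; exact: measurable_consRd.
- apply/trivIsetP => /= i j _ _ ij; rewrite -preimage_setI.
  by move/trivIsetP : tF => /(_ _ _ _ _ ij) ->//; rewrite preimage_set0.
- rewrite -preimage_bigcup -[X in measurable X]setTI.
  exact: measurable_consRd.
Qed.

HB.instance Definition _ := isMeasure.Build _ _ _ (lebesgueS mu)
  lebesgueS0 lebesgueS_ge0 lebesgueS_sigma_additive.

Let lebesgueS_sigma_finite : sigma_finite setT (lebesgueS mu).
Proof.
have /sigma_finiteP[F [TF ndF Foo]] := sigma_finiteT (@lebesgue_measure R).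
have /sigma_finiteP[G [TG ndG Goo]] := sigma_finiteT mu.
exists (fun n => @unconsRd d @^-1` (F n `*` G n)).
  rewrite -preimage_bigcup; apply/esym; rewrite -subTset => t _ /=.
  have [n _ Fn] : (\bigcup_n F n) (unconsRd t).1 by rewrite -TF.
  have [k _ Gk] : (\bigcup_n G n) (unconsRd t).2 by rewrite -TG.
  exists (maxn n k) => //; split.
  - by move: Fn; exact/subsetPset/ndF/leq_maxl.
  - by move: Gk; exact/subsetPset/ndG/leq_maxr.
move=> k; have [mFk Fkoo] := Foo k; have [mGk Gkoo] := Goo k; split.
  rewrite -[X in measurable X]setTI.
  by apply: measurable_unconsRd => //; exact: measurableX.
rewrite /lebesgueS /pushforward -comp_preimage.
rewrite (_ : _ \o _ = id); last by apply/funext => x /=; rewrite consRdK.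
by rewrite preimage_id product_measure1E// lte_mul_pinfty// ge0_fin_numE.
Qed.

HB.instance Definition _ := Measure_isSigmaFinite.Build _ _ _ (lebesgueS mu)
  lebesgueS_sigma_finite.

End lebesgueS_instances.

Fixpoint lebesgueRd (d : nat) : {sigma_finite_measure set (Rd R d) -> \bar R} :=
  match d with
  | 0 => \d_[tuple]
  | d'.+1 => lebesgueS (lebesgueRd d')
  end.

End lebesgue_Rd.

Section euclidean.
Context {R : realType} {d : nat}.
Implicit Types x y : Rd R d.

Definition enorm x : R := Num.sqrt (\sum_(i < d) (tnth x i : R) ^+ 2).

Definition subRd x y : Rd R d := [tuple (tnth x i : R) - tnth y i | i < d].

Lemma enorm_ge0 x : 0 <= enorm x.
Proof. exact: sqrtr_ge0. Qed.

Lemma enorm_sqr x : enorm x ^+ 2 = \sum_(i < d) (tnth x i : R) ^+ 2.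
Proof. by rewrite sqr_sqrtr// sumr_ge0// => i _; exact: sqr_ge0. Qed.

End euclidean.

Section gaussian.
Context {R : realType}.

Definition gaussian_density (d : nat) (x : Rd R d) : R :=
  pi `^ (- (d%:R / 2)) * expR (- enorm x ^+ 2).

(* The Gaussian measure, with density pi^(-d/2) e^(-|x|^2). *)
Definition gaussian (d : nat) (A : set (Rd R d)) : \bar R :=
  (\int[lebesgueRd d]_(x in A) (gaussian_density x)%:E)%E.

Lemma gaussian_density_ge0 d (x : Rd R d) : 0 <= gaussian_density x.
Proof. by rewrite mulr_ge0 ?powR_ge0 ?expR_ge0. Qed.

Lemma measurable_enorm_sqr d :
  measurable_fun setT (fun x : Rd R d => enorm x ^+ 2).
Proof.
under eq_fun do rewrite enorm_sqr.
apply: measurable_sum => i; apply: measurable_funX; exact: measurable_tnth.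
Qed.

Lemma measurable_expR_enorm d :
  measurable_fun setT (fun x : Rd R d => expR (- enorm x ^+ 2)).
Proof.
apply: measurableT_comp => //; apply: measurableT_comp => //.
exact: measurable_enorm_sqr.
Qed.

Lemma measurable_gaussian_density d :
  measurable_fun setT (@gaussian_density d).
Proof. by apply: measurable_funM => //; exact: measurable_expR_enorm. Qed.

Lemma expR_enorm_consRd d (x : R) (t : Rd R d) :
  expR (- enorm (consRd (x, t)) ^+ 2) = gauss_fun x * expR (- enorm t ^+ 2).
Proof.
rewrite !enorm_sqr big_ord_recl opprD expRD /consRd tnth0.
by under eq_bigr do rewrite tnthS.
Qed.

Lemma integral_expR_enorm d :
  (\int[lebesgueRd d]_x (expR (- enorm x ^+ 2))%:E)%E =
  ((Num.sqrt pi : R) ^+ d)%:E.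
Proof.
elim: d => [|d IHd].
  rewrite /= integral_dirac//; last first.
    by apply/measurable_EFinP; exact: measurable_expR_enorm.
  by rewrite diracT mul1e enorm_sqr big_ord0 oppr0 expR0 expr0.
rewrite [lebesgueRd d.+1]/= /lebesgueS.
rewrite ge0_integral_pushforward//=; last 2 first.
- exact: measurable_consRd.
- by apply/measurable_EFinP; exact: measurable_expR_enorm.
rewrite preimage_setT fubini_tonelli1//=; last first.
  apply/measurable_EFinP.
  apply: (measurableT_comp (@measurable_expR_enorm d.+1)).
  exact: measurable_consRd.
transitivity (\int[@lebesgue_measure R]_x
    ((Num.sqrt pi ^+ d)%:E * (gauss_fun x)%:E))%E.
  apply: eq_integral => x _; rewrite /fubini_F/=.
  under eq_integral do rewrite expR_enorm_consRd EFinM.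
  rewrite ge0_integralZl//=; last 2 first.
  - by apply/measurable_EFinP; exact: measurable_expR_enorm.
  - by rewrite lee_fin gauss_fun_ge0.
  by rewrite IHd muleC.
rewrite ge0_integralZl//=; last 2 first.
- by apply/measurable_EFinP; exact: measurable_gauss_fun.
- by move=> x _; rewrite lee_fin gauss_fun_ge0.
by rewrite integralT_gauss -EFinM exprSr.
Qed.

Section gaussian_instances.
Variable d : nat.

Let gaussian0 : gaussian (@set0 (Rd R d)) = 0%E.
Proof. by rewrite /gaussian integral_set0. Qed.

Let gaussian_ge0 (A : set (Rd R d)) : (0 <= gaussian A)%E.
Proof.
by apply: integral_ge0 => x _; rewrite lee_fin gaussian_density_ge0.
Qed.

Let gaussian_sigma_additive : semi_sigma_additive (@gaussian d).
Proof.
apply: semi_sigma_additive_nng_induced.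
  by apply/measurable_EFinP; exact: measurable_gaussian_density.
by move=> x; rewrite lee_fin gaussian_density_ge0.
Qed.

HB.instance Definition _ := isMeasure.Build _ _ _ (@gaussian d)
  gaussian0 gaussian_ge0 gaussian_sigma_additive.

Let gaussian_setT : gaussian [set: Rd R d] = 1%E.
Proof.
rewrite /gaussian /gaussian_density.
under eq_integral do rewrite EFinM.
rewrite ge0_integralZl//=; last 2 first.
- by apply/measurable_EFinP; exact: measurable_expR_enorm.
- by rewrite lee_fin powR_ge0.
rewrite integral_expR_enorm -EFinM -powR_mulrn ?sqrtr_ge0//.
rewrite -powR12_sqrt ?pi_ge0// -powRrM -powRD; last first.
  by apply/implyP => _; rewrite gt_eqF// pi_gt0.
by rewrite mulrC addrC subrr powRr0.
Qed.

HB.instance Definition _ := Measure_isProbability.Build _ _ _ (@gaussian d)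
  gaussian_setT.

End gaussian_instances.

End gaussian.

Section local_muckenhoupt.
Context {R : realType} {d : nat}.
Implicit Types (x y : Rd R d) (Q : set (Rd R d)) (u v w f : Rd R d -> R)
  (a p q alpha beta : R).

Local Notation gamma := (@gaussian R d).

(* Cubes are closed; boundaries of cubes are gamma-negligible. *)
Definition cube x (r : R) : set (Rd R d) :=
  [set y | forall i, `|(tnth y i : R) - tnth x i| <= r / 2].

(* min(1, 1/|x|); the case x = 0 is singled out because 0^-1 = 0. *)
Definition mfunction x : R :=
  if enorm x == 0 then 1 else Num.min 1 (enorm x)^-1.

Definition admissible_cubes a : set (set (Rd R d)) :=
  [set Q | exists c l, [/\ 0 < l, l <= a * mfunction c & Q = cube c l]].

(* Compactness refers to the topology of the library on row vectors. *)
Definition locally_integrableRd w :=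
  measurable_fun setT w /\
  forall K : set 'rV[R]_d, compact K ->
    (\int[lebesgueRd d]_(x in [set x | K (\row_i tnth x i)%R]) `|w x|%:E
      < +oo)%E.

Definition weight w := locally_integrableRd w /\ {ae gamma, forall x, 0 <= w x}.

Definition in_Lp p v f :=
  measurable_fun setT f /\
  (\int[gamma]_x (`|f x| `^ p * v x)%:E < +oo)%E.

Local Open Scope ereal_scope.

(* At y = x, where gamma(Q(x, 0)) = 0, the kernel is 1/0 = +oo. *)
Definition frac_integrand alpha f x y : \bar R :=
  (f y)%:E / gamma (cube x (enorm (subRd x y))) `^ (1 - alpha / d%:R).

Definition local_frac_integral a alpha f x : \bar R :=
  let Qx := cube x (a * mfunction x) in
  if `[< gamma.-integrable Qx (frac_integrand alpha f x) >]
  then \int[gamma]_(y in Qx) frac_integrand alpha f x y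
  else +oo.

Definition gavg Q (g : Rd R d -> \bar R) : \bar R :=
  (gamma Q)^-1 * \int[gamma]_(x in Q) g x.

Definition ess_sup_on Q (g : Rd R d -> \bar R) : \bar R :=
  ess_sup gamma (patch (cst -oo) Q g).

(* In \bar R, 0^-1 = +oo and 0 * +oo = 0. Negative powers of v are written as
   inverses of positive ones because powers of 0 with nonzero exponent are 0
   in the library; thus v^(1 - p') is +oo where v = 0. *)
Definition muckenhoupt_gt1 p q beta a :
    set ((Rd R d -> R) * (Rd R d -> R)) :=
  [set uv | let u := uv.1 in let v := uv.2 in
    let p' := (p / (p - 1))%R in
    ereal_sup [set gamma Q `^ (beta / d%:R + q^-1 - p^-1)
                   * gavg Q (fun x => (u x)%:E) `^ q^-1
                   * gavg Q (fun x => ((v x)%:E `^ (p' - 1))^-1) `^ p'^-1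
              | Q in admissible_cubes a] < +oo].

Definition muckenhoupt_eq1 q beta a :
    set ((Rd R d -> R) * (Rd R d -> R)) :=
  [set uv | let u := uv.1 in let v := uv.2 in
    ereal_sup [set ess_sup_on Q (fun x =>
                     gamma Q `^ (beta / d%:R + q^-1 - 1)
                     * gavg Q (fun x => (u x)%:E) `^ q^-1
                     * (v x)%:E^-1)
              | Q in admissible_cubes a] < +oo].

(* The class A_{p,q,beta}^a. *)
Definition muckenhoupt p q beta a : set ((Rd R d -> R) * (Rd R d -> R)) :=
  if p == 1%R then muckenhoupt_eq1 q beta a else muckenhoupt_gt1 p q beta a.

End local_muckenhoupt.

(* Main.v *)
Require Import Defs.
From mathcomp Require Import all_boot all_order all_algebra.
From mathcomp Require Import all_classical all_reals all_analysis.
From mathcomp Require Import measurable_realfun ess_sup_inf ring lra zify.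
Import Order.TTheory GRing.Theory Num.Theory.
Local Open Scope classical_set_scope.
Local Open Scope ring_scope.

Set Implicit Arguments.
Unset Strict Implicit.
Unset Printing Implicit Defensive.
Import numFieldNormedType.Exports.

(** Write [m] for [mfunction], [t_k = 2^-k], and let the pair of weights
    satisfy the condition with parameters [b > a] and [beta < alpha].

    Because [beta < alpha] holds strictly, every dyadic scale can be treated
    separately, with a gain that is geometric in the scale.

    Cutting [cube x (a m(x))] into dyadic annuli around [x] gives
    ([frac_integral_domination])
      [I f(x) <= sum_k gamma(cube x (t_k a m(x) / 4))^(alpha/d - 1)
                       * int_(cube x (t_k a m(x))) |f|].
    For each [k], [cube x (t_k a m(x))] is contained in a cube [P] of side
    [t_k b m(c)] and centre [c] taken from a countable family that does not
    depend on [x]; the room between [a] and [b] pays for moving the centre.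
    On cubes of this size the Gaussian density is constant up to a factor, so
    the k-th term is at most
    [C t_k^(alpha - beta) gamma(P)^(beta/d - 1) int_P |f|] ([kernel_le_cube]).
    With [theta = 2^(-(alpha - beta)/2)] the gain [t_k^(alpha - beta)] equals
    [theta^(2 k)]. Hence if [I f(x) > lambda], then for some [k] the point [x]
    lies in a cube [P] of the k-th family such that
    [gamma(P)^(beta/d - 1) int_P |f|] exceeds a threshold proportional to
    [lambda theta^-k] ([frac_integral_large_cube]).

    The Muckenhoupt condition and Hoelder's inequality bound the [u]-mass of
    such a cube by a constant times
    [(theta^k / lambda)^q (int_P |f|^p v)^(q/p)] ([muckenhoupt_cube],
    [weak_type_of_product]). The k-th family splits into finitely many
    subfamilies of disjoint cubes, their number being independent of [k]
    ([local_cube_covering]); as [q >= p], the powers of the integrals over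
    disjoint cubes add up to at most [(int |f|^p v)^(q/p)]
    ([sum_power_integral_disjoint]). It remains to sum the geometric series of
    ratio [theta^q] over [k]. *)

(** * Cubes and the local scale *)

Section geometry.
Context {R : realType} {d : nat}.
Implicit Types (x y c : Rd R d) (l h : R).

Lemma enorm_coord x (i : 'I_d) : `|tnth x i : R| <= enorm x.
Proof.
rewrite -(ler_pXn2r (n := 2)) ?nnegrE ?enorm_ge0//.
by rewrite real_normK ?num_real// enorm_sqr (bigD1 i)//= lerDl sumr_ge0// =>
  j _; exact: sqr_ge0.
Qed.

Lemma sum_sqr_le_sqr_sum (n : nat) (z : 'I_n -> R) : (forall i, 0 <= z i) ->
  \sum_(i < n) z i ^+ 2 <= (\sum_(i < n) z i) ^+ 2.
Proof.
move=> z0; rewrite [leRHS]expr2 mulr_suml; apply: ler_sum => i _.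
rewrite expr2 ler_wpM2l// (bigD1 i)//= lerDl sumr_ge0//.
Qed.

(** The triangle inequality with the increment measured in the sup norm. It
    follows from expanding the square, since every coordinate of [x] is at most
    [enorm x]. *)
Lemma enorm_le_shift x y h :
  (forall i, `|(tnth y i : R) - tnth x i| <= h) -> enorm y <= enorm x + d%:R * h.
Proof.
move=> yx.
pose S := \sum_(i < d) `|(tnth y i : R) - tnth x i|.
have S0 : 0 <= S by rewrite sumr_ge0.
apply: (@le_trans _ _ (enorm x + S)); last first.
  rewrite lerD2l /S (le_trans (ler_sum _ (fun i _ => yx i)))//.
  by rewrite sumr_const card_ord mulr_natl.
rewrite -(ler_pXn2r (n := 2)) ?nnegrE ?enorm_ge0 ?addr_ge0 ?enorm_ge0//.
rewrite sqrrD !enorm_sqr.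
have -> : \sum_(i < d) (tnth y i : R) ^+ 2 =
    \sum_(i < d) (tnth x i : R) ^+ 2 +
    (\sum_(i < d) (tnth x i : R) * (tnth y i - tnth x i)) *+ 2 +
    \sum_(i < d) ((tnth y i : R) - tnth x i) ^+ 2.
  rewrite -sumrMnl -!big_split/=; apply: eq_bigr => i _; ring.
have A : \sum_(i < d) (tnth x i : R) * (tnth y i - tnth x i) <= enorm x * S.
  rewrite /S mulr_sumr; apply: ler_sum => i _.
  rewrite (le_trans (ler_norm _))// normrM ler_wpM2r//; exact: enorm_coord.
have B : \sum_(i < d) ((tnth y i : R) - tnth x i) ^+ 2 <= S ^+ 2.
  rewrite /S; apply: le_trans (@sum_sqr_le_sqr_sum d _ _) => //.
  by apply: ler_sum => i _; rewrite real_normK ?num_real.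
by rewrite !mulr2n; lra.
Qed.

Lemma enorm_ge_coord x y (i : 'I_d) :
  `|(tnth x i : R) - tnth y i| <= enorm (subRd x y).
Proof.
by have := enorm_coord (subRd x y) i; rewrite /subRd tnth_mktuple.
Qed.

Lemma measurable_cube c l : measurable (cube c l).
Proof.
have -> : cube c l = \bigcap_(i in [set: 'I_d])
    ((fun y : Rd R d => tnth y i : R) @^-1` `[tnth c i - l / 2, tnth c i + l / 2]).
  apply/seteqP; split => y /= h i => [_|]; rewrite /= ?in_itv/=.
    by rewrite -ler_distl; exact: h.
  by rewrite ler_distl; have := h i I; rewrite /= in_itv.
apply: fin_bigcap_measurable => // i _; rewrite -[X in measurable X]setTI.
exact: measurable_tnth.
Qed.

(** This is [1 / mfunction x]. Being Lipschitz and at least 1, it varies at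
    most by a constant factor on sets of bounded diameter. *)
Definition inv_mfunction x : R := Num.max 1 (enorm x).

Lemma inv_mfunction_ge1 x : 1 <= inv_mfunction x.
Proof. by rewrite /inv_mfunction le_max lexx. Qed.

Lemma inv_mfunction_gt0 x : 0 < inv_mfunction x.
Proof. exact: lt_le_trans (inv_mfunction_ge1 x). Qed.

Lemma mfunctionE x : mfunction x = (inv_mfunction x)^-1.
Proof.
rewrite /mfunction /inv_mfunction; case: eqP => [->|/eqP x0].
  by rewrite max_l ?invr1.
have xgt0 : 0 < enorm x by rewrite lt_neqAle eq_sym x0 enorm_ge0.
have [x1|x1] := leP (enorm x) 1.
  by rewrite invr1 min_l// invf_ge1.
by rewrite min_r// invf_le1// ltW.
Qed.

Lemma mfunction_gt0 x : 0 < mfunction x.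
Proof. by rewrite mfunctionE invr_gt0 inv_mfunction_gt0. Qed.

Lemma mfunction_le1 x : mfunction x <= 1.
Proof. by rewrite mfunctionE invf_le1 ?inv_mfunction_gt0// inv_mfunction_ge1. Qed.

Lemma enorm_le_inv_mfunction x : enorm x <= inv_mfunction x.
Proof. by rewrite /inv_mfunction le_max lexx orbT. Qed.

Lemma inv_mfunction_shift x y h : 0 <= h ->
  (forall i, `|(tnth y i : R) - tnth x i| <= h) -> inv_mfunction y <= inv_mfunction x + d%:R * h.
Proof.
move=> h0 /enorm_le_shift yx.
have dh0 : 0 <= d%:R * h by rewrite mulr_ge0.
have := enorm_le_inv_mfunction x; have := inv_mfunction_ge1 x => h1 h2.
rewrite {1}/inv_mfunction ge_max; apply/andP; split; lra.
Qed.

Lemma cube_sym x y l : cube x l y -> cube y l x.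
Proof. by move=> h i; rewrite distrC; exact: h. Qed.

Lemma cube_center c l : 0 <= l -> cube c l c.
Proof. by move=> l0 i; rewrite subrr normr0 divr_ge0. Qed.

Lemma cube0 c : (cube c 0 = [set c])%classic.
Proof.
apply/seteqP; split => y /= => [h|->]; last exact: cube_center.
apply: eq_from_tnth => i; apply/eqP; rewrite -subr_eq0 -normr_le0.
by have := h i; rewrite mul0r.
Qed.

Lemma sub_cube c l1 l2 : l1 <= l2 -> cube c l1 `<=` cube c l2.
Proof.
by move=> l12 y h i; rewrite (le_trans (h i))// ler_pM2r.
Qed.

Lemma inv_mfunction_cube c l x : 0 <= l -> cube c l x ->
  inv_mfunction x <= inv_mfunction c + d%:R * (l / 2).
Proof. by move=> l0; apply: inv_mfunction_shift; rewrite divr_ge0. Qed.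

(** The local scale is essentially constant on a local cube, because the side
    of the cube is at most [b] while the reciprocal scale is Lipschitz and at
    least 1. *)
Lemma mfunction_comparable b t c x : 0 < b -> 0 < t -> t <= 1 ->
  cube c (t * b * mfunction c) x ->
  inv_mfunction x <= (1 + d%:R * b) * inv_mfunction c /\
  inv_mfunction c <= (1 + d%:R * b) * inv_mfunction x.
Proof.
move=> b0 t0 t1 cx.
have m0 := mfunction_gt0 c; have m1 := mfunction_le1 c.
have l0 : 0 <= t * b * mfunction c by rewrite !mulr_ge0// ltW.
have lb : t * b * mfunction c <= b.
  by rewrite -[leRHS]mulr1 ler_pM// ?mulr_ge0// ?(ltW t0) ?(ltW b0) ?(ltW m0)//
     ler_piMl// ltW.
have h1 := inv_mfunction_cube l0 cx; have h2 := inv_mfunction_cube l0 (cube_sym cx).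
have rx := inv_mfunction_ge1 x; have rc := inv_mfunction_ge1 c.
have dl : d%:R * (t * b * mfunction c / 2) <= d%:R * b.
  by rewrite ler_wpM2l//; lra.
have db : 0 <= d%:R * b by rewrite mulr_ge0// ltW.
split; nra.
Qed.

End geometry.

(** * Gaussian measure of local cubes *)

Section gaussian_cubes.
Context {R : realType}.

Lemma lebesgue_cube (d : nat) (c : Rd R d) (l : R) : 0 <= l ->
  lebesgueRd d (cube c l) = (l ^+ d)%:E.
Proof.
move=> l0; elim: d c => [|d IHd] c.
  rewrite /= diracE mem_set//; by case.
rewrite /= /lebesgueS /pushforward.
have -> : (@consRd R d) @^-1` (cube c l) =
    `[(tnth c ord0 : R) - l / 2, (tnth c ord0 : R) + l / 2]%classic `*`
    cube [tuple of behead c] l.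
  apply/seteqP; split => -[x t] /=.
    move=> h; split => /=.
      by rewrite /= in_itv/= -ler_distl; have := h ord0; rewrite /consRd tnth0.
    move=> i; have := h (lift ord0 i).
    by rewrite /consRd tnthS/= tnth_behead; congr (`|_ - tnth c _| <= _);
      apply/val_inj => /=; rewrite inordK// ltnS.
  rewrite in_itv/= -ler_distl => -[h0 h1] i.
  case: (unliftP ord0 i) => [j|] ->; last by rewrite /consRd tnth0.
  have := h1 j; rewrite /consRd tnthS/= tnth_behead.
  by congr (`|_ - tnth c _| <= _); apply/val_inj => /=; rewrite inordK// ltnS.
rewrite product_measure1E//; last exact: measurable_cube.
rewrite exprS EFinM -(IHd [tuple of behead c]); congr (_ * _)%E.
transitivity (@lebesgue_measure R
  `[(tnth c ord0 : R) - l / 2, (tnth c ord0 : R) + l / 2]%classic); first by [].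
rewrite lebesgue_measure_itv/= lte_fin; case: ifPn => h.
  by rewrite -EFinD; congr (_%:E); lra.
by congr (_%:E); lra.
Qed.

Context {d : nat}.
Implicit Types (x y c : Rd R d) (l h b t : R).
Local Notation gamma := (@gaussian R d).

Lemma gaussian_le_lebesgue (A : set (Rd R d)) (M : R) : measurable A -> 0 <= M ->
  (forall y, A y -> gaussian_density y <= M) ->
  (gamma A <= M%:E * lebesgueRd d A)%E.
Proof.
move=> mA M0 h; rewrite /gaussian -integral_cst//.
apply: ge0_le_integral => //.
- by move=> y _; rewrite lee_fin gaussian_density_ge0.
- by apply/measurable_EFinP; apply: measurable_funTS; exact: measurable_gaussian_density.
Qed.

Lemma gaussian_ge_lebesgue (A : set (Rd R d)) (M : R) : measurable A -> 0 <= M ->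
  (forall y, A y -> M <= gaussian_density y) ->
  (M%:E * lebesgueRd d A <= gamma A)%E.
Proof.
move=> mA M0 h; rewrite /gaussian -integral_cst//.
apply: ge0_le_integral => //.
by apply/measurable_EFinP; apply: measurable_funTS; exact: measurable_gaussian_density.
Qed.

Lemma gaussian_density_le1 x : gaussian_density x <= 1.
Proof.
rewrite /gaussian_density -[leRHS]mulr1 ler_pM ?powR_ge0 ?expR_ge0//; last first.
  by rewrite -expR0 ler_expR oppr_le0 sqr_ge0.
have p2 : 1 < (pi : R) by have := @pi_ge2 R; lra.
rewrite /powR gt_eqF ?pi_gt0// -expR0 ler_expR mulNr oppr_le0 mulr_ge0//.
by rewrite ln_ge0// ltW.
Qed.

Lemma gaussian_cube_le c l : 0 <= l -> (gamma (cube c l) <= (l ^+ d)%:E)%E.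
Proof.
move=> l0; rewrite -(@lebesgue_cube d c)// -[leRHS]mul1e.
apply: gaussian_le_lebesgue => //; first exact: measurable_cube.
by move=> y _; exact: gaussian_density_le1.
Qed.

(** Bound for the ratio of two values of the Gaussian density in a local cube,
    one of them at the centre. *)
Definition density_oscillation b : R := expR (d%:R * b + (d%:R * b) ^+ 2).

(** A displacement of length [h] changes [|c|^2] by at most [2 |c| h + h^2];
    in a local cube [h] is at most a multiple of [b * mfunction c], and
    [|c| * mfunction c <= 1]. *)
Lemma gaussian_density_comparable b t c y : 0 < b -> 0 < t -> t <= 1 ->
  cube c (t * b * mfunction c) y ->
  gaussian_density y <= density_oscillation b * gaussian_density c /\
  gaussian_density c <= density_oscillation b * gaussian_density y.
Proof.
move=> b0 t0 t1 cy; rewrite /density_oscillation; set D := expR _.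
have m0 := mfunction_gt0 c; have m1 := mfunction_le1 c.
pose m := mfunction c.
have h1 := enorm_le_shift cy.
have cy' := cube_sym cy; have h2 := enorm_le_shift cy'.
have em : enorm c * m <= 1.
  by rewrite /m mfunctionE ler_pdivrMr ?inv_mfunction_gt0// mul1r enorm_le_inv_mfunction.
have ec := enorm_ge0 c; have ey := enorm_ge0 y.
have d0 : 0 <= d%:R :> R by [].
have dbm : d%:R * (t * b * m / 2) <= d%:R * b * m / 2.
  rewrite -!mulrA ler_wpM2l//.
  by rewrite ler_piMl// !mulr_ge0// ?invr_ge0// ltW.
set E := d%:R * b * m / 2 in dbm.
have E0 : 0 <= E by rewrite /E !mulr_ge0 ?invr_ge0// ltW.
have hE1 : enorm y <= enorm c + E by rewrite (le_trans h1)// lerD2l.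
have hE2 : enorm c <= enorm y + E by rewrite (le_trans h2)// lerD2l.
have Eec : E * enorm c <= d%:R * b / 2.
  have -> : E * enorm c = d%:R * b / 2 * (enorm c * m) by rewrite /E; ring.
  by rewrite ler_piMr// !mulr_ge0 ?invr_ge0// ltW.
have Edb : E <= d%:R * b / 2.
  by rewrite /E mulrAC ler_piMr// !mulr_ge0 ?invr_ge0// ltW.
set F := d%:R * b in Eec Edb D *.
have F0 : 0 <= F by rewrite /F mulr_ge0// ltW.
have EE : E ^+ 2 <= F ^+ 2 / 4 by nra.
rewrite /gaussian_density mulrCA [X in _ /\ _ <= X]mulrCA -!expRD.
split; rewrite ler_wpM2l ?powR_ge0// ler_expR.
  have : enorm c ^+ 2 <= enorm y ^+ 2 + 2 * (E * enorm c) + E^+2.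
    have [ce|ce] := leP (enorm c) (enorm y); nra.
  by nra.
have : enorm y ^+ 2 <= enorm c ^+ 2 + 2 * (E * enorm c) + E^+2 by nra.
by nra.
Qed.

(** On a local cube the Gaussian measure is Lebesgue measure up to a constant
    factor, hence doubling. *)
Lemma gaussian_cube_doubling b t c x (r k : R) : 0 < b -> 0 < t -> t <= 1 ->
  0 < r -> t * b * mfunction c <= k * r ->
  cube x r `<=` cube c (t * b * mfunction c) ->
  (gamma (cube c (t * b * mfunction c)) <=
   (density_oscillation b ^+ 2 * k ^+ d)%:E * gamma (cube x r))%E.
Proof.
move=> b0 t0 t1 r0 Lk sub; pose D := density_oscillation b; rewrite -/D.
set L := t * b * mfunction c in Lk sub *.
have L0 : 0 < L by rewrite !mulr_gt0// mfunction_gt0.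
have k0 : 0 < k by rewrite -(pmulr_lgt0 _ r0) (lt_le_trans L0).
have D0 : 0 < D by exact: expR_gt0.
have rho0 := gaussian_density_ge0 c.
apply: (@le_trans _ _ ((D * gaussian_density c)%:E * (L ^+ d)%:E)%E).
  rewrite -(@lebesgue_cube _ c)// ?(ltW L0)//.
  apply: gaussian_le_lebesgue.
  - exact: measurable_cube.
  - exact: mulr_ge0 (ltW D0) rho0.
  - by move=> y cy; have [] := gaussian_density_comparable b0 t0 t1 cy.
apply: (@le_trans _ _ ((D ^+ 2 * k ^+ d)%:E *
    ((D^-1 * gaussian_density c)%:E * (r ^+ d)%:E))%E); last first.
  rewrite lee_wpmul2l ?lee_fin ?mulr_ge0 ?exprn_ge0 ?(ltW D0) ?(ltW k0)//.
  rewrite -(@lebesgue_cube _ x)// ?(ltW r0)//.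
  apply: gaussian_ge_lebesgue.
  - exact: measurable_cube.
  - by apply: mulr_ge0 => //; rewrite invr_ge0 ltW.
  - move=> y /sub cy; rewrite ler_pdivrMl//.
    by have [] := gaussian_density_comparable b0 t0 t1 cy.
rewrite -!EFinM lee_fin.
have -> : D ^+ 2 * k ^+ d * (D^-1 * gaussian_density c * r ^+ d) =
    D * gaussian_density c * ((k * r) ^+ d).
  by rewrite exprMn; field; rewrite gt_eqF.
rewrite (ler_wpM2l (mulr_ge0 (ltW D0) rho0))// lerXn2r ?nnegrE ?(ltW L0)//.
by rewrite mulr_ge0 ?ltW.
Qed.

Lemma gaussian_cube_gt0 c l : 0 < l -> (0 < gamma (cube c l))%E.
Proof.
move=> l0.
have m0 := mfunction_gt0 c.
have b0 : 0 < l / mfunction c by rewrite divr_gt0.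
have o0 : 0 < density_oscillation (l / mfunction c) by exact: expR_gt0.
have rho0 : 0 < gaussian_density c.
  by rewrite mulr_gt0 ?expR_gt0// powR_gt0// pi_gt0.
pose M := (density_oscillation (l / mfunction c))^-1 * gaussian_density c.
have M0 : 0 < M by rewrite mulr_gt0// invr_gt0.
apply: (@lt_le_trans _ _ (M%:E * lebesgueRd d (cube c l))%E).
  by rewrite (@lebesgue_cube d c) ?ltW// -EFinM lte_fin mulr_gt0// exprn_gt0.
apply: gaussian_ge_lebesgue; [exact: measurable_cube | exact: ltW |].
move=> y cy; rewrite ler_pdivrMl//.
have := @gaussian_density_comparable (l / mfunction c) 1 c y b0 ltr01 (lexx _).
by rewrite mul1r divfK ?gt_eqF// => /(_ cy)[].
Qed.

Lemma gaussian_set1 x : (0 < d)%N -> gamma [set x] = 0%E.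
Proof.
move=> d0; rewrite -cube0.
apply/eqP; rewrite eq_le measure_ge0 andbT.
by rewrite (le_trans (gaussian_cube_le _ _))// expr0n gtn_eqF.
Qed.

End gaussian_cubes.

(** * Covering by finitely many disjoint families of local cubes *)

Section covering.
Context {R : realType} {d : nat}.
Implicit Types (x y c : Rd R d) (a b t eta : R).

Definition lattice_point (s : R) (n : d.-tuple int) : Rd R d :=
  [tuple s * (tnth n i)%:~R | i < d].

Lemma dyadic_level (r : R) : 1 <= r ->
  exists j : nat, 2 ^+ j <= r /\ r < 2 ^+ j.+1.
Proof.
move=> r1.
have r0 : 0 <= r by lra.
pose n := Num.truncn r.
have n0 : (0 < n)%N by rewrite -Num.Theory.truncn_gt0 in r1 *.
exists (trunc_log 2 n).
have /andP[h1 h2] := @trunc_log_bounds 2 n erefl n0.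
have /andP[nr rn] := Num.Theory.truncn_itv r0; split.
  by rewrite (le_trans _ nr)// -natrX ler_nat.
by rewrite (lt_le_trans rn)// -natrX ler_nat.
Qed.

(** Two levels whose powers of 2 are comparable differ by less than [J]; levels
    congruent modulo [J] are therefore equal by [eqn_mod_close]. *)
Lemma dyadic_levels_close (j k J : nat) (K : R) : K < 2 ^+ J ->
  2 ^+ j <= K * 2 ^+ k -> (j < k + J)%N.
Proof.
move=> KJ jk; have : 2 ^+ j < 2 ^+ (k + J) :> R.
  by rewrite (le_lt_trans jk)// exprD mulrC ltr_pM2l// exprn_gt0.
by rewrite ltr_eXn2l// ltr1n.
Qed.

Lemma eqn_mod_close (j k J : nat) : (j < k + J)%N -> (k < j + J)%N ->
  (j = k %[mod J])%N -> j = k.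
Proof.
wlog jk : j k / (j <= k)%N => [hw h1 h2 h3|h1 h2 h3].
  by case/orP: (leq_total j k) => ?; [exact: hw|apply/esym; exact: hw].
apply/eqP; rewrite eqn_leq jk/=; move/esym/eqP: h3; rewrite eqn_mod_dvd// => hd.
case: (posnP (k - j)) => [|p]; first lia.
by have := dvdn_leq p hd; lia.
Qed.

Lemma eqz_mod_close (m n : int) (L : nat) : `|m - n| < L%:Z ->
  (m = n %[mod L])%Z -> m = n.
Proof.
move=> h /eqP; rewrite eqz_mod_dvd => hd.
apply/eqP; rewrite -subr_eq0 -absz_eq0; move: hd; rewrite /dvdz/= => hd.
case: posnP => // p; have := dvdn_leq p hd; lia.
Qed.

(** At every scale [t] each cube [cube x (t a m(x))] lies in one of countably
    many slightly larger local cubes, and these fall into finitely many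
    classes (colours) of pairwise disjoint cubes; the number of colours does
    not depend on [t]. Where [1 / m] is of size [2^j], the centres are the
    points of a lattice of step [eta t / 2^j], with [eta] so small that moving
    [x] to a lattice point is absorbed by the gap between [a] and [b]. A point
    of an enlarged cube determines its level [j] and the integer coordinates of
    its centre up to bounded errors, so colouring by residues makes cubes of the
    same colour disjoint. *)
Lemma local_cube_covering a b : 0 < a -> a < b -> exists F : finType,
  forall t, 0 < t -> t <= 1 -> exists (c : F -> nat -> Rd R d) (D : F -> set nat),
    (forall x, exists i n, D i n /\
       cube x (t * a * mfunction x) `<=` cube (c i n) (t * b * mfunction (c i n)))
    /\ (forall i, trivIset (D i) (fun n => cube (c i n) (t * b * mfunction (c i n)))).
Proof.
move=> a0 ab.
have b0 : 0 < b by lra.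
have d0 : 0 <= d%:R :> R by [].
(* the last condition is the room left by the gap between a and b *)
have [eta [eta0 eta1 etad etab]] : exists eta : R,
    [/\ 0 < eta, eta <= 1, d%:R * eta <= 1 & (a + 4 * eta) * (1 + d%:R * eta) <= b].
  pose e1 : R := (d%:R + 1)^-1.
  have W0 : 0 < 4 + d%:R * a + 4 * d%:R by nra.
  pose e2 : R := (b - a) / (4 + d%:R * a + 4 * d%:R).
  have e10 : 0 < e1 by rewrite invr_gt0; lra.
  have e20 : 0 < e2 by rewrite divr_gt0//; lra.
  have h1 : Num.min e1 e2 <= e1 by rewrite ge_min lexx.
  have h2 : Num.min e1 e2 <= e2 by rewrite ge_min lexx orbT.
  have h0 : 0 < Num.min e1 e2 by rewrite lt_min e10.
  set e := Num.min e1 e2 in h0 h1 h2.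
  have ee1 : e * (d%:R + 1) <= 1 by rewrite -ler_pdivlMr ?div1r//; lra.
  have ee2 : e * (4 + d%:R * a + 4 * d%:R) <= b - a by rewrite -ler_pdivlMr.
  have ed0 : 0 <= d%:R * e by rewrite mulr_ge0// ltW.
  have e1' : e <= 1 by lra.
  have ede : d%:R * e * e <= d%:R * e by rewrite ler_piMr.
  exists e; split => //; first lra.
  have -> : (a + 4 * e) * (1 + d%:R * e) =
    a + e * (4 + d%:R * a) + 4 * (d%:R * e * e) by ring.
  lra.
(* K bounds the ratio of 2^j for two cubes with a common point, and 2 b / eta the
   difference of the lattice coordinates of their centres *)
pose K := 8 * (1 + d%:R * b) ^+ 2.
have [J KJ] : exists J : nat, K < 2 ^+ J.
  exists (Num.truncn K).+1.
  have h : 0 <= K by rewrite mulr_ge0// sqr_ge0.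
  have /andP[_ /lt_trans] := Num.Theory.truncn_itv h; apply.
  by rewrite -natrX ltr_nat ltn_expl.
pose L := (Num.truncn (2 * b / eta)).+1.
have LP : 2 * b / eta < L%:R.
  have h : 0 <= 2 * b / eta by rewrite !mulr_ge0 ?invr_ge0// ltW.
  by have /andP[_] := Num.Theory.truncn_itv h.
exists ('I_J.+1 * {ffun 'I_d -> 'I_L})%type => t t0 t1.
pose step j : R := eta * t / 2 ^+ j.
have step0 j : 0 < step j by rewrite divr_gt0 ?exprn_gt0// mulr_gt0.
pose center (w : nat * d.-tuple int) := lattice_point (step w.1) w.2.
(* up to rounding, the level of the centre is the level of the lattice *)
pose valid (w : nat * d.-tuple int) :=
  2 ^+ w.1 <= 2 * inv_mfunction (center w) /\ inv_mfunction (center w) <= 4 * 2 ^+ w.1.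
pose color (w : nat * d.-tuple int) : 'I_J.+1 * {ffun 'I_d -> 'I_L} :=
  (inord (w.1 %% J.+1), [ffun i => inord (absz (tnth w.2 i %% L)%Z)]).
(* the default value is never reached: only codes of lattice points are selected *)
pose dec n : nat * d.-tuple int := odflt (0%N, [tuple 0 | i < d]) (unpickle n).
exists (fun=> center \o dec),
  (fun i => [set n | exists w, [/\ n = pickle w, valid w & color w = i]]).
have decK w : dec (pickle w) = w by rewrite /dec pickleK.
split.
  move=> x.
  have [j [jl ju]] := dyadic_level (inv_mfunction_ge1 x).
  have P2 : 0 < 2 ^+ j :> R by rewrite exprn_gt0.
  pose n : d.-tuple int := [tuple Num.floor ((tnth x i : R) / step j) | i < d].
  pose w := (j, n).
  have cw i : `|(tnth x i : R) - tnth (center w) i| <= step j.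
    rewrite /center /lattice_point !tnth_mktuple/=.
    have /andP[f1 f2] := Num.Theory.floor_itv ((tnth x i : R) / step j).
    rewrite ler_pdivlMr// in f1; rewrite ltr_pdivrMr// in f2.
    rewrite intrD mulrDl mul1r in f2.
    rewrite ger0_norm; rewrite [step j * _]mulrC; lra.
  have cw' i : `|(tnth (center w) i : R) - tnth x i| <= step j by rewrite distrC.
  have stepeta : step j <= eta.
    rewrite /step ler_pdivrMr// ler_pM2l// (le_trans t1)//.
    by rewrite -[leLHS](expr1n _ j) lerXn2r// ?nnegrE// ler1n.
  have dstep : d%:R * step j <= d%:R * eta by rewrite ler_wpM2l.
  have n1 := inv_mfunction_shift (ltW (step0 j)) cw.
  have n2 := inv_mfunction_shift (ltW (step0 j)) cw'.
  have r1 := inv_mfunction_ge1 x; have r2 := inv_mfunction_ge1 (center w).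
  exists (color w), (pickle w); rewrite /= decK; split.
    exists w; split => //; rewrite /valid/=; split; first by lra.
    by move: ju; rewrite exprS; lra.
  set c := center w in cw cw' n1 n2 r2 *.
  have mx : step j <= 2 * eta * t * mfunction x.
    rewrite mfunctionE /step ler_pdivrMr// -[leLHS]mulr1.
    have -> : 2 * eta * t * (inv_mfunction x)^-1 * 2 ^+ j =
        eta * t * (2 * 2 ^+ j / inv_mfunction x).
      by ring.
    rewrite ler_pM2l ?mulr_gt0// ler_pdivlMr ?inv_mfunction_gt0// mul1r.
    by rewrite -exprS ltW.
  have mc : mfunction x <= (1 + d%:R * eta) * mfunction c.
    rewrite !mfunctionE ler_pdivlMr ?inv_mfunction_gt0// ler_pdivrMl ?inv_mfunction_gt0//.
    have : 0 <= d%:R * eta by nra.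
    nra.
  have mx0 := mfunction_gt0 x; have mc0 := mfunction_gt0 c.
  move=> y xy i.
  have := ler_distD (tnth x i : R) (tnth y i : R) (tnth c i : R).
  move=> /le_trans; apply.
  apply: (le_trans (lerD (xy i) (cw i))).
  apply: (@le_trans _ _ (t * ((a + 4 * eta) * mfunction x) / 2)); first by lra.
  rewrite -!mulrA ler_pM2l// !mulrA ler_pM2r//.
  apply: (@le_trans _ _ ((a + 4 * eta) * ((1 + d%:R * eta) * mfunction c))).
    by rewrite ler_pM2l//; lra.
  by rewrite mulrA ler_pM2r.
move=> i _ _ [w1 [-> v1 co1]] [w2 [-> v2 co2]] [y [/=]]; rewrite !decK.
suff : forall w1 w2, valid w1 -> valid w2 -> color w1 = color w2 ->
    cube (center w1) (t * b * mfunction (center w1)) y ->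
    cube (center w2) (t * b * mfunction (center w2)) y -> w1 = w2.
  by move=> H y1 y2; rewrite (H _ _ v1 v2 _ y1 y2)// co1 co2.
move=> {w1 w2 v1 v2 co1 co2} [j1 n1] [j2 n2] [/= v11 v12] [/= v21 v22] co y1 y2.
have [y11 y12] := mfunction_comparable b0 t0 t1 y1.
have [y21 y22] := mfunction_comparable b0 t0 t1 y2.
set c1 := center (j1, n1) in v11 v12 y1 y11 y12.
set c2 := center (j2, n2) in v21 v22 y2 y21 y22.
have B1 : 1 <= 1 + d%:R * b by rewrite lerDl mulr_ge0// ltW.
have le12 : 2 ^+ j1 <= K * 2 ^+ j2.
  apply: (le_trans v11).
  apply: (@le_trans _ _ (2 * ((1 + d%:R * b) * ((1 + d%:R * b) * (4 * 2 ^+ j2))))).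
    rewrite ler_pM2l// (le_trans y12)// ler_pM2l; last lra.
    by rewrite (le_trans y21)// ler_pM2l//; lra.
  by rewrite /K; lra.
have le21 : 2 ^+ j2 <= K * 2 ^+ j1.
  apply: (le_trans v21).
  apply: (@le_trans _ _ (2 * ((1 + d%:R * b) * ((1 + d%:R * b) * (4 * 2 ^+ j1))))).
    rewrite ler_pM2l// (le_trans y22)// ler_pM2l; last lra.
    by rewrite (le_trans y11)// ler_pM2l//; lra.
  by rewrite /K; lra.
have J12 := dyadic_levels_close KJ le12.
have J21 := dyadic_levels_close KJ le21.
case: co => /(congr1 val)/=; rewrite !inordK ?ltn_mod// => cj cn.
have jj : j1 = j2 by apply: (@eqn_mod_close _ _ J.+1); rewrite ?addnS// ltnW.
subst j2; congr (_, _).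
apply: eq_from_tnth => k.
have P2 : 0 < 2 ^+ j1 :> R by rewrite exprn_gt0.
apply: (@eqz_mod_close _ _ L).
  have m1 : mfunction c1 <= 2 / 2 ^+ j1.
    by rewrite mfunctionE -div1r ler_pdivrMr ?inv_mfunction_gt0// mulrAC ler_pdivlMr// mul1r.
  have m2 : mfunction c2 <= 2 / 2 ^+ j1.
    by rewrite mfunctionE -div1r ler_pdivrMr ?inv_mfunction_gt0// mulrAC ler_pdivlMr// mul1r.
  have := ler_distD (tnth y k : R) (tnth c1 k : R) (tnth c2 k : R).
  rewrite (distrC (tnth c1 k : R) (tnth y k : R)).
  move=> /le_trans /(_ (lerD (y1 k) (y2 k))).
  rewrite /c1 /c2 /center /lattice_point !tnth_mktuple/= -/c1 -/c2.
  rewrite -mulrBr -intrB normrM gtr0_norm// => h.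
  have h2 : step j1 * `|(tnth n1 k - tnth n2 k)%:~R| <= step j1 * (2 * b / eta).
    apply: (le_trans h).
    have -> : step j1 * (2 * b / eta) = t * b * (2 / 2 ^+ j1).
      by rewrite /step; field; rewrite !gt_eqF.
    have : t * b * mfunction c1 <= t * b * (2 / 2 ^+ j1).
      by rewrite ler_pM2l// mulr_gt0.
    have : t * b * mfunction c2 <= t * b * (2 / 2 ^+ j1).
      by rewrite ler_pM2l// mulr_gt0.
    lra.
  rewrite ler_pM2l// in h2.
  have := le_lt_trans h2 LP.
  by rewrite -intr_norm pmulrn ltr_int.
move/ffunP/(_ k): cn; rewrite !ffunE => /(congr1 val)/=.
have modL (z : int) : (absz (z %% L)%Z < L)%N.
  by rewrite -ltz_nat gez0_abs ?ltz_pmod ?modz_ge0.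
rewrite !inordK ?modL// => /(congr1 Posz).
by rewrite !gez0_abs ?modz_ge0.
Qed.

End covering.

(** * The Muckenhoupt condition on a single cube *)

Section muckenhoupt_cubes.
Context {R : realType} {d : nat}.
Implicit Types (x y c : Rd R d) (Q : set (Rd R d)) (u v f : Rd R d -> R) (p q beta b : R).
Local Notation gamma := (@gaussian R d).
Local Open Scope ereal_scope.

Lemma gaussian_fin Q : measurable Q -> gamma Q \is a fin_num.
Proof. by move=> mQ; exact: fin_num_measure. Qed.

(** The exponents [1/q] and [1/p] of [gamma(Q)] in the Muckenhoupt quantity
    undo the normalisation of the averages, up to one factor [1 / gamma(Q)]. *)
Lemma gavg_normalization (g : R) (U S : \bar R) (beta q' r s : R) :
  (0 < g)%R -> 0 <= U -> 0 <= S -> (r + s = 1)%R ->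
  g%:E `^ (beta + q' - r) * (g%:E^-1 * U) `^ q' * (g%:E^-1 * S) `^ s =
  g%:E `^ (beta - 1) * (U `^ q' * S `^ s).
Proof.
move=> g0 U0 S0 rs.
have gi0 : 0 <= g%:E^-1 by rewrite inve_ge0 lee_fin ltW.
have gi (w : R) : g%:E^-1 `^ w = (g `^ (- w))%:E.
  by rewrite inver gt_eqF// poweR_EFin -powR_inv1 ?ltW// -powRrM mulN1r.
rewrite !poweRM// !gi !poweR_EFin.
rewrite -!muleA [in RHS](_ : beta - 1 = (beta + q' - r) + (- q' + - s))%R; last first.
  by rewrite -rs; ring.
rewrite (@powRD _ g (beta + q' - r)); last by rewrite (gt_eqF g0) implybT.
rewrite (@powRD _ g (- q')); last by rewrite (gt_eqF g0) implybT.
rewrite 2!EFinM -!muleA; congr (_ * (_ * _)).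
by rewrite muleCA.
Qed.

Lemma measurable_inve_power v (s : R) : measurable_fun setT v ->
  measurable_fun setT (fun x => ((v x)%:E `^ s)^-1).
Proof.
move=> mv.
have -> : (fun x => ((v x)%:E `^ s)^-1) =
    (fun x => if (v x `^ s == 0)%R then +oo else ((v x `^ s) `^ (-1))%R%:E).
  by apply/funext => x; rewrite poweR_EFin inver powR_inv1// powR_ge0.
have mvs : measurable_fun setT (fun x => (v x `^ s)%R).
  exact: (measurableT_comp (measurable_powR s)).
apply: measurable_fun_ifT => //; first exact: measurable_fun_eqr.
by apply/measurable_EFinP; exact: (measurableT_comp (measurable_powR (-1))).
Qed.

(** Hoelder for [|f| v^(1/p)] and [v^(-1/p)]. Almost everywhere positivity of
    [v] is essential: where [v] vanishes the product of these two functions is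
    not [|f|]. *)
Lemma hoelder_weight p v f Q : (1 < p)%R -> measurable Q ->
  measurable_fun setT v -> (forall x, 0 <= v x)%R -> measurable_fun setT f ->
  {ae gamma, forall x, Q x -> (0 < v x)%R} ->
  \int[gamma]_(x in Q) `|f x|%:E <=
  (\int[gamma]_(x in Q) (`|f x| `^ p * v x)%:E) `^ p^-1 *
  (\int[gamma]_(x in Q) ((v x)%:E `^ (p / (p - 1) - 1))^-1) `^ (p / (p - 1))^-1.
Proof.
move=> p1 mQ mv v0 mf vpos; set p' := (p / (p - 1))%R.
have p0 : (0 < p)%R by lra.
have p'0 : (0 < p')%R by rewrite divr_gt0//; lra.
pose F x := (`|f x| * v x `^ p^-1 * \1_Q x)%R.
pose G x := ((v x `^ p^-1) `^ (-1) * \1_Q x)%R.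
have mF : measurable_fun setT F.
  apply: measurable_funM; last exact: measurable_indic.
  apply: measurable_funM; first exact: measurableT_comp.
  exact: (measurableT_comp (measurable_powR _)).
have mG : measurable_fun setT G.
  apply: measurable_funM; last exact: measurable_indic.
  apply: (measurableT_comp (measurable_powR _)).
  exact: (measurableT_comp (measurable_powR _)).
have conj : (p^-1 + p'^-1 = 1)%R by rewrite /p'; field; apply/andP; split; lra.
have := @hoelder _ _ _ gamma F G p p' mF mG p0 p'0 conj.
rewrite Lnorm1 unlock.
have -> : \int[gamma]_x `|(EFin \o (F \* G)%R) x| = \int[gamma]_(x in Q) `|f x|%:E.
  rewrite [RHS]integral_mkcond; apply: ge0_ae_eq_integral => //.
  - apply/measurable_EFinP; apply: measurableT_comp => //.
    exact: measurable_funM.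
  - apply/(measurable_restrictT _ _).1 => //.
    by apply/measurable_EFinP; apply: measurable_funTS; exact: measurableT_comp.
  - by move=> x _; rewrite patchE; case: ifP.
  - apply: filterS vpos => x vx _ /=; rewrite patchE /F /G.
    case: ifPn => [xQ|xQ]; last by rewrite indicE (negbTE xQ) mulr0 mul0r normr0.
    rewrite indicE xQ !mulr1 powR_inv1 ?powR_ge0// -mulrA divff ?mulr1 ?normr_id//.
    by rewrite gt_eqF// powR_gt0// vx// -in_setE.
have -> : \int[gamma]_x `|(EFin \o F) x| `^ p = \int[gamma]_(x in Q) (`|f x| `^ p * v x)%:E.
  rewrite [RHS]integral_mkcond; apply: eq_integral => x _ /=.
  rewrite patchE /F /= ?abse_EFin ?poweR_EFin; case: ifPn => [xQ|xQ]; last first.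
    by rewrite indicE (negbTE xQ) mulr0 normr0 powR0// gt_eqF.
  rewrite indicE xQ mulr1 ger0_norm ?mulr_ge0 ?powR_ge0//.
  by rewrite powRM ?powR_ge0// -powRrM mulVf ?gt_eqF// powRr1.
have -> : \int[gamma]_x `|(EFin \o G) x| `^ p' =
    \int[gamma]_(x in Q) ((v x)%:E `^ (p' - 1))^-1.
  rewrite [RHS]integral_mkcond; apply: ge0_ae_eq_integral => //.
  - apply: (measurableT_comp (measurable_poweR _)).
    by apply/measurable_EFinP; exact: measurableT_comp.
  - apply/(measurable_restrictT _ _).1 => //.
    by apply: measurable_funTS; exact: measurable_inve_power.
  - by move=> x _; exact: poweR_ge0.
  - by move=> x _; rewrite patchE; case: ifP => // _; rewrite inve_ge0 poweR_ge0.
  - apply: filterS vpos => x vx _ /=; rewrite patchE /G /= ?poweR_EFin.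
    case: ifPn => [xQ|xQ]; last first.
      by rewrite indicE (negbTE xQ) mulr0 normr0 powR0// gt_eqF.
    have vx0 : (0 < v x)%R by rewrite vx// -in_setE.
    rewrite indicE xQ mulr1 ger0_norm ?powR_ge0// -!powRrM inver.
    rewrite gt_eqF ?powR_gt0// -(@powR_inv1 _ (v x `^ (p' - 1))%R) ?powR_ge0// -powRrM.
    congr ((_ `^ _)%R%:E); rewrite /p'; field; apply/andP; split; lra.
by [].
Qed.

(** The dual weight is infinite where [v] vanishes. *)
Lemma weight_pos_ae v Q (s : R) : (0 < s)%R -> measurable Q ->
  measurable_fun setT v -> (forall x, 0 <= v x)%R ->
  \int[gamma]_(x in Q) ((v x)%:E `^ s)^-1 < +oo ->
  {ae gamma, forall x, Q x -> (0 < v x)%R}.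
Proof.
move=> s0 mQ mv v0 fin.
have : gamma.-integrable Q (fun x => ((v x)%:E `^ s)^-1).
  apply/integrableP; split.
    by apply: measurable_funTS; exact: measurable_inve_power.
  under eq_integral do rewrite gee0_abs ?inve_ge0 ?poweR_ge0//.
  exact: fin.
move=> /(integrable_ae mQ); apply: filterS => x h /h.
rewrite poweR_EFin inver lt_neqAle v0 andbT.
by case: (eqVneq 0%R (v x)) => // <-; rewrite powR0 ?eqxx// gt_eqF.
Qed.

Lemma measurable_admissible_cube b Q : admissible_cubes b Q -> measurable Q.
Proof. by move=> [c [l [_ _ ->]]]; exact: measurable_cube. Qed.

Lemma admissible_cube_gt0 b Q : admissible_cubes b Q -> 0 < gamma Q.
Proof. by move=> [c [l [l0 _ ->]]]; exact: gaussian_cube_gt0. Qed.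

Lemma ae_eq_pos_part u : {ae gamma, forall x, 0 <= u x}%R ->
  {ae gamma, forall x, u x = u^\+ x}%R.
Proof. by apply: filterS => x ux; rewrite /funrpos max_l. Qed.

Lemma ae_eq_integral_gaussian Q (g h : Rd R d -> \bar R) : measurable Q ->
  measurable_fun setT g -> measurable_fun setT h ->
  {ae gamma, forall x, g x = h x} ->
  \int[gamma]_(x in Q) g x = \int[gamma]_(x in Q) h x.
Proof.
move=> mQ mg mh gh.
apply: ae_eq_integral => //; [exact: measurable_funTS | exact: measurable_funTS |].
by apply: filterS gh => x ->.
Qed.

Lemma ereal_sup_real_bound (A : set (\bar R)) : ereal_sup A < +oo ->
  exists K : R, (0 < K)%R /\ forall z, A z -> z <= K%:E.
Proof.
move=> supA; exists (Num.max 1 (fine (ereal_sup A)))%R.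
split; first by rewrite lt_max ltr01.
move=> z /ereal_sup_ubound/le_trans; apply.
case: (ereal_sup A) supA => [r| |] // _; last by rewrite leNye.
by rewrite lee_fin le_max lexx orbT.
Qed.

Lemma muckenhoupt_gt1_bound p q beta b u v : (1 < p)%R ->
  weight u -> weight v -> muckenhoupt_gt1 p q beta b (u, v) ->
  exists K : R, (0 < K)%R /\ forall Q, admissible_cubes b Q ->
    gamma Q `^ (beta / d%:R - 1) *
    ((\int[gamma]_(x in Q) (u^\+ x)%R%:E) `^ q^-1 *
     (\int[gamma]_(x in Q) ((v^\+ x)%R%:E `^ (p / (p - 1) - 1))^-1)
       `^ (p / (p - 1))^-1) <= K%:E.
Proof.
move=> p1 [[mu _] u0] [[mv _] v0] /ereal_sup_real_bound [K [K0 AK]].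
have mup := measurable_funrpos mu; have mvp := measurable_funrpos mv.
exists K; split => // Q aQ.
have mQ := measurable_admissible_cube aQ; have gQ0 := admissible_cube_gt0 aQ.
have gQf := gaussian_fin mQ.
have := AK _ (ex_intro2 _ _ Q aQ erefl); rewrite /= /gavg.
rewrite (@ae_eq_integral_gaussian Q _ (fun x => (u^\+ x)%R%:E)) //; first last.
- by apply: filterS (ae_eq_pos_part u0) => x <-.
- exact/measurable_EFinP.
- exact/measurable_EFinP.
rewrite (@ae_eq_integral_gaussian Q (fun x => ((v x)%:E `^ (p / (p - 1) - 1))^-1)
    (fun x => ((v^\+ x)%R%:E `^ (p / (p - 1) - 1))^-1)) //; first last.
- by apply: filterS (ae_eq_pos_part v0) => x <-.
- exact: measurable_inve_power.
- exact: measurable_inve_power.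
rewrite -{1 2 3}(fineK gQf) gavg_normalization ?fineK//.
- by rewrite fine_gt0// gQ0 ltey_eq gQf.
- by apply: integral_ge0 => x _; rewrite lee_fin funrpos_ge0.
- by apply: integral_ge0 => x _; rewrite inve_ge0 poweR_ge0.
- by field; apply/andP; split; lra.
Qed.

(** If [u] has no mass in [Q] there is nothing to prove. Otherwise the
    Muckenhoupt bound forces the integral of the dual weight to be finite, so
    that [v] is positive almost everywhere in [Q] and Hoelder applies. *)
Lemma muckenhoupt_gt1_cube (K p q w : R) u v f Q : (0 < K)%R -> (1 < p)%R -> (0 < q)%R ->
  measurable Q -> 0 < gamma Q ->
  measurable_fun setT u -> measurable_fun setT v ->
  (forall x, 0 <= u x)%R -> (forall x, 0 <= v x)%R ->
  gamma Q `^ w *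
    ((\int[gamma]_(x in Q) (u x)%:E) `^ q^-1 *
     (\int[gamma]_(x in Q) ((v x)%:E `^ (p / (p - 1) - 1))^-1)
       `^ (p / (p - 1))^-1) <= K%:E ->
  measurable_fun setT f ->
  gamma Q `^ w * (\int[gamma]_(x in Q) (u x)%:E) `^ q^-1 *
      \int[gamma]_(x in Q) `|f x|%:E <=
  K%:E * (\int[gamma]_(x in Q) (`|f x| `^ p * v x)%:E) `^ p^-1.
Proof.
move=> K0 p1 q0 mQ gQ0 mu mv u0 v0 AK mf.
set U := \int[gamma]_(x in Q) (u x)%:E in AK *.
set S := \int[gamma]_(x in Q) _ in AK.
set G := \int[gamma]_(x in Q) (`|f x| `^ p * v x)%:E.
set F := \int[gamma]_(x in Q) `|f x|%:E.
have p'1 : (1 < p / (p - 1))%R by rewrite ltr_pdivlMr ?mul1r; lra.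
have U0 : 0 <= U by apply: integral_ge0 => x _; rewrite lee_fin.
have S0 : 0 <= S by apply: integral_ge0 => x _; rewrite inve_ge0 poweR_ge0.
have [->|Upos] := eqVneq U 0.
  rewrite poweR0r ?invr_eq0 ?gt_eqF// mule0 mul0e mule_ge0 ?poweR_ge0//.
  by rewrite lee_fin ltW.
have {}Upos : 0 < U by rewrite lt0e Upos.
have gp : 0 < gamma Q `^ w by exact: poweR_gt0.
have Sfin : S < +oo.
  rewrite ltey; apply/eqP => Soo; move: AK.
  rewrite Soo poweRyr ?invr_eq0; last by rewrite gt_eqF//; lra.
  by rewrite gt0_muley ?poweR_gt0// gt0_muley.
have vpos : {ae gamma, forall x, Q x -> (0 < v x)%R}.
  by apply: weight_pos_ae Sfin => //; lra.
have FH : F <= G `^ p^-1 * S `^ (p / (p - 1))^-1 by exact: hoelder_weight.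
apply: (@le_trans _ _ (gamma Q `^ w * U `^ q^-1 *
   (G `^ p^-1 * S `^ (p / (p - 1))^-1))).
  by rewrite lee_wpmul2l// mule_ge0 ?poweR_ge0.
rewrite muleCA -muleA muleC lee_wpmul2r ?poweR_ge0//.
Qed.

Lemma muckenhoupt_eq1_bound q beta b u v :
  weight u -> weight v -> muckenhoupt_eq1 q beta b (u, v) ->
  exists K : R, (0 < K)%R /\ forall Q, admissible_cubes b Q ->
    {ae gamma, forall x, Q x ->
      gamma Q `^ (beta / d%:R - 1) *
      (\int[gamma]_(x in Q) (u^\+ x)%R%:E) `^ q^-1 * (v^\+ x)%R%:E^-1 <= K%:E}.
Proof.
move=> [[mu _] u0] [[mv _] v0] /ereal_sup_real_bound [K [K0 AK]].
have mup := measurable_funrpos mu; have mvp := measurable_funrpos mv.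
exists K; split => // Q aQ.
have mQ := measurable_admissible_cube aQ; have gQ0 := admissible_cube_gt0 aQ.
have gQf := gaussian_fin mQ.
have /ess_supP := AK _ (ex_intro2 _ _ Q aQ erefl); rewrite /= /gavg.
apply: filterS2 (ae_eq_pos_part v0) => x vx + Qx.
rewrite /patch mem_set// -vx.
rewrite (@ae_eq_integral_gaussian Q _ (fun x => (u^\+ x)%R%:E)) //; first last.
- by apply: filterS (ae_eq_pos_part u0) => y <-.
- exact/measurable_EFinP.
- exact/measurable_EFinP.
set U := \int[gamma]_(x in Q) _.
have := @gavg_normalization (fine (gamma Q)) U 0 (beta / d%:R) q^-1 1 0.
rewrite fineK// poweRe0 poweRe0 !mule1 => -> //.
- by rewrite fine_gt0// gQ0 ltey_eq gQf.
- by apply: integral_ge0 => y _; rewrite lee_fin funrpos_ge0.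
- by rewrite addr0.
Qed.

Lemma muckenhoupt_eq1_cube (K : R) (w : \bar R) v f Q : (0 < K)%R -> 0 <= w ->
  measurable Q -> measurable_fun setT v -> (forall x, 0 <= v x)%R ->
  {ae gamma, forall x, Q x -> w * (v x)%:E^-1 <= K%:E} ->
  measurable_fun setT f ->
  w * \int[gamma]_(x in Q) `|f x|%:E <=
  K%:E * (\int[gamma]_(x in Q) (`|f x| * v x)%:E).
Proof.
move=> K0 w0 mQ mv v0 AK mf.
have mfQ : measurable_fun Q (fun x => `|f x|%:E).
  by apply/measurable_EFinP; apply: measurable_funTS; exact: measurableT_comp.
have mfv : measurable_fun Q (fun x => (`|f x| * v x)%:E).
  apply/measurable_EFinP; apply: measurable_funTS; apply: measurable_funM => //.
  exact: measurableT_comp.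
have [->|wpos] := eqVneq w 0.
  rewrite mul0e mule_ge0//; first by rewrite lee_fin ltW.
  by apply: integral_ge0 => x _; rewrite lee_fin mulr_ge0.
have {}wpos : 0 < w by rewrite lt0e wpos.
rewrite -ge0_integralZl// -ge0_integralZl//; last 2 first.
- by move=> x _; rewrite lee_fin mulr_ge0.
- by rewrite lee_fin ltW.
apply: ae_ge0_le_integral => //.
- by move=> x _; rewrite mule_ge0.
- exact: emeasurable_funM.
- by move=> x _; rewrite -EFinM lee_fin !mulr_ge0// ltW.
- exact: emeasurable_funM.
apply: filterS AK => x h /h.
rewrite inver; case: eqVneq => [_|vx0]; first by rewrite gt0_muley.
have vx : (0 < v x)%R by rewrite lt_neqAle eq_sym vx0 v0.
rewrite lee_pdivrMr// => {}h.
have f0 : 0 <= `|f x|%:E by rewrite lee_fin.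
apply: (le_trans (lee_wpmul2r f0 h)).
by rewrite -!EFinM lee_fin -mulrA (mulrC (v x)).
Qed.

(** The only consequence of the Muckenhoupt condition used for the weak type
    inequality; it has the same form for [p = 1] and [p > 1]. Positive parts
    turn weights that are nonnegative almost everywhere into nonnegative
    functions. *)
Lemma muckenhoupt_cube p q beta b u v : (1 <= p)%R -> (0 < q)%R ->
  weight u -> weight v -> muckenhoupt p q beta b (u, v) ->
  exists K : R, (0 < K)%R /\
  forall Q, admissible_cubes b Q -> forall f, measurable_fun setT f ->
    gamma Q `^ (beta / d%:R - 1) * (\int[gamma]_(x in Q) (u^\+ x)%R%:E) `^ q^-1 *
      \int[gamma]_(x in Q) `|f x|%:E <=
    K%:E * (\int[gamma]_(x in Q) (`|f x| `^ p * v^\+ x)%R%:E) `^ p^-1.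
Proof.
move=> p1 q0 wu wv.
have [[mu _] _] := wu; have [[mv _] _] := wv.
have mup := measurable_funrpos mu; have mvp := measurable_funrpos mv.
have up : forall x, (0 <= u^\+ x)%R by move=> x; exact: funrpos_ge0.
have vp : forall x, (0 <= v^\+ x)%R by move=> x; exact: funrpos_ge0.
rewrite /muckenhoupt; case: eqP => [-> | /eqP pn1].
  move=> /(muckenhoupt_eq1_bound wu wv)[K [K0 H]].
  exists K; split => // Q aQ f mf; rewrite invr1 poweRe1; last first.
    by apply: integral_ge0 => x _; rewrite lee_fin mulr_ge0 ?powR_ge0.
  under [X in _ <= _ * X]eq_integral do rewrite powRr1//.
  apply: muckenhoupt_eq1_cube => //; last exact: H.
  - by rewrite mule_ge0 ?poweR_ge0.
  - exact: measurable_admissible_cube aQ.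
have {}p1 : (1 < p)%R by rewrite lt_neqAle eq_sym pn1.
move=> /(muckenhoupt_gt1_bound p1 wu wv)[K [K0 H]].
exists K; split => // Q aQ f mf; apply: muckenhoupt_gt1_cube => //.
- exact: measurable_admissible_cube aQ.
- exact: admissible_cube_gt0 aQ.
- exact: H.
Qed.

End muckenhoupt_cubes.

(** * Dyadic decomposition of the fractional integral *)

Section domination.
Context {R : realType} {d : nat}.
Implicit Types (x y c : Rd R d) (Q : set (Rd R d)) (f : Rd R d -> R).
Local Notation gamma := (@gaussian R d).
Local Open Scope ereal_scope.

(** Real-valued, so that the powers of these measures obey the rules for real
    powers. *)
Definition gcube x (r : R) : R := fine (gamma (cube x r)).

Lemma gcubeE x (r : R) : gamma (cube x r) = (gcube x r)%:E.
Proof. by rewrite /gcube fineK// gaussian_fin//; exact: measurable_cube. Qed.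

Lemma gcube_gt0 x r : (0 < r)%R -> (0 < gcube x r)%R.
Proof. by move=> r0; rewrite -lte_fin -gcubeE gaussian_cube_gt0. Qed.

Lemma le_gcube x r s : (r <= s)%R -> (gcube x r <= gcube x s)%R.
Proof.
move=> rs; rewrite -lee_fin -!gcubeE; apply: le_measure; rewrite ?inE;
  [exact: measurable_cube | exact: measurable_cube | exact: sub_cube].
Qed.

(** A monotone function of the radius, composed with the distance to [x]. *)
Lemma measurable_gcube_dist x :
  measurable_fun setT (fun y => gcube x (enorm (subRd x y))).
Proof.
apply: (@measurableT_comp _ _ _ _ _ _ (gcube x)).
  by apply: nondecreasing_measurable => // r s; exact: le_gcube.
apply: (@measurableT_comp _ _ _ _ _ _ (@Num.sqrt R)).
  by apply: nondecreasing_measurable => // r s; exact: ler_wsqrtr.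
rewrite (_ : (fun y => _) = (fun y : Rd R d => \sum_(i < d) ((tnth x i : R) - tnth y i) ^+ 2)%R).
  apply: measurable_sum => i; apply: measurable_funX.
  by apply: measurable_funB => //; exact: measurable_tnth.
by apply/funext => y; apply: eq_bigr => i _; rewrite tnth_mktuple.
Qed.

Lemma measurable_frac_integrand (alpha : R) f x : measurable_fun setT f ->
  measurable_fun setT (frac_integrand alpha f x).
Proof.
move=> mf; rewrite /frac_integrand.
apply: emeasurable_funM; first exact/measurable_EFinP.
under eq_fun do rewrite gcubeE.
exact: (measurable_inve_power _ (measurable_gcube_dist x)).
Qed.

Lemma abse_frac_integrand alpha f x y :
  `|frac_integrand alpha f x y| =
  `|f y|%:E * (gamma (cube x (enorm (subRd x y))) `^ (1 - alpha / d%:R))^-1.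
Proof.
rewrite /frac_integrand abseM; congr (_ * _).
by rewrite gee0_abs// inve_ge0 poweR_ge0.
Qed.

(** Where the integral does not converge absolutely, the value [+oo] of the
    operator is matched by the integral of the absolute value: as the integrand
    is measurable, non-integrability can only come from the size. *)
Lemma local_frac_integral_lt a alpha f x (lambda : R) : measurable_fun setT f ->
  lambda%:E < local_frac_integral a alpha f x ->
  lambda%:E < \int[gamma]_(y in cube x (a * mfunction x))
    `|frac_integrand alpha f x y|.
Proof.
move=> mf; rewrite /local_frac_integral; case: ifPn => [_ h|].
  apply: (lt_le_trans h); apply: (le_trans (lee_abs _)).
  apply: le_abse_integral; first exact: measurable_cube.
  by apply: measurable_funTS; exact: measurable_frac_integrand.
move=> /asboolPn h _; rewrite ltNge; apply/negP => h2; apply: h.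
apply/integrableP; split.
  by apply: measurable_funTS; exact: measurable_frac_integrand.
by rewrite (le_lt_trans h2)// ltry.
Qed.

Lemma dyadic_annulus (h : R) x y : (0 < h)%R -> cube x h y -> y <> x ->
  exists k : nat, cube x (2^-1 ^+ k * h) y /\
    (2^-1 ^+ k * h / 4 <= enorm (subRd x y))%R.
Proof.
move=> h0 xy yx.
(* the shrinking cubes must eventually leave y out, since y differs from x;
   the annulus is the one just before the first time this happens *)
have exN : exists n, `[< ~ cube x (2^-1 ^+ n * h) y >].
  apply/not_existsP => H; apply: yx.
  have {}H n i : (`|(tnth y i : R) - tnth x i| <= 2^-1 ^+ n * h / 2)%R.
    by have /negP := H n; rewrite asbool_neg negbK => /asboolP; apply.
  apply: eq_from_tnth => i; apply/eqP; rewrite -subr_eq0 -normr_le0 leNgt.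
  apply/negP; set z := `|_|%R => z0.
  have [n hn] : exists n : nat, (h / z < n%:R)%R.
    exists (Num.truncn (h / z)).+1.
    by have /andP[_] := Num.Theory.truncn_itv (divr_ge0 (ltW h0) (ltW z0)).
  have := H n i; rewrite -/z.
  have p2 : (n%:R < 2 ^+ n :> R)%R by rewrite -natrX ltr_nat ltn_expl.
  rewrite exprVn mulrAC -mulrA mulrC ler_pdivlMr ?exprn_gt0//.
  rewrite ltr_pdivrMr// in hn.
  have : (n%:R * z < 2 ^+ n * z)%R by rewrite ltr_pM2r.
  lra.
case: (ex_minnP exN) => k /asboolP Pk kmin.
case: k Pk kmin => [|k] Pk kmin.
  by exfalso; apply: Pk; rewrite expr0 mul1r.
exists k; split.
  apply: contrapT => Pk'; have := kmin k; rewrite ltnn => H.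
  by move: (H (asboolT Pk')).
move: Pk => /existsNP[i /negP]; rewrite -ltNge exprS => hi.
have := enorm_ge_coord x y i; rewrite distrC; lra.
Qed.

(** On the annulus of index [k] the kernel, which decreases in the distance, is
    at most its value at the inner radius. *)
Lemma kernel_domination (s h : R) f x y : (0 < s)%R -> (0 < h)%R ->
  cube x h y -> y <> x ->
  `|f y|%:E * (gamma (cube x (enorm (subRd x y))) `^ s)^-1 <=
  \sum_(0 <= k <oo)
    (gcube x (2^-1 ^+ k * h / 4) `^ (- s))%:E *
     (`|f y| * \1_(cube x (2^-1 ^+ k * h)) y)%:E.
Proof.
move=> s0 h0 xy yx.
have [k [k1 k2]] := dyadic_annulus h0 xy yx.
pose F (k : nat) : \bar R := (gcube x (2^-1 ^+ k * h / 4) `^ (- s))%:E *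
  (`|f y| * \1_(cube x (2^-1 ^+ k * h)) y)%:E.
have F0 n : 0 <= F n by rewrite /F -EFinM lee_fin !mulr_ge0// powR_ge0.
have r0 : (0 < 2^-1 ^+ k * h / 4)%R.
  by rewrite !mulr_gt0// ?exprn_gt0// invr_gt0.
apply: (@le_trans _ _ (F k)); last first.
  have hF := @nneseries_lim_ge R F xpredT 0 k.+1 (fun n _ _ => F0 n).
  apply: le_trans hF.
  by rewrite big_nat_recr//= leeDr// sume_ge0.
rewrite /F indicE mem_set// mulr1 muleC lee_wpmul2r ?lee_fin//.
have g0 := gcube_gt0 x r0; have g1 := le_gcube x k2.
rewrite gcubeE; move: g0 g1.
move: (gcube x (2^-1 ^+ k * h / 4)%R) (gcube x (enorm (subRd x y))) => g g' g0 g1.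
have g'0 : (0 < g')%R := lt_le_trans g0 g1.
rewrite poweR_EFin inver gt_eqF ?powR_gt0//.
rewrite lee_fin powRN.
have h1 : (0 < g `^ s)%R by exact: powR_gt0.
have h2 : (0 < g' `^ s)%R by exact: powR_gt0.
rewrite lef_pV2 ?posrE//.
by apply: ge0_ler_powR; rewrite ?nnegrE// ltW.
Qed.

(** The point [y = x], where the kernel is infinite, is negligible. *)
Lemma frac_integral_domination (s h : R) f x : (0 < d)%N -> (0 < s)%R -> (0 < h)%R ->
  measurable_fun setT f ->
  measurable_fun setT (fun y => `|f y|%:E * (gamma (cube x (enorm (subRd x y))) `^ s)^-1) ->
  \int[gamma]_(y in cube x h)
    (`|f y|%:E * (gamma (cube x (enorm (subRd x y))) `^ s)^-1) <=
  \sum_(0 <= k <oo)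
    (gcube x (2^-1 ^+ k * h / 4) `^ (- s))%:E *
     \int[gamma]_(y in cube x (2^-1 ^+ k * h)) `|f y|%:E.
Proof.
move=> d0 s0 h0 mf mk.
have mcube := @measurable_cube R d.
have mf1 k : measurable_fun setT (fun y => (`|f y| * \1_(cube x (2^-1 ^+ k * h)) y)%:E).
  apply/measurable_EFinP; apply: measurable_funM; first exact: measurableT_comp.
  exact: measurable_indic.
pose F (k : nat) y : \bar R := (gcube x (2^-1 ^+ k * h / 4) `^ (- s))%:E *
     (`|f y| * \1_(cube x (2^-1 ^+ k * h)) y)%:E.
have F0 n y : 0 <= F n y by rewrite /F -EFinM lee_fin !mulr_ge0// powR_ge0.
have mF n : measurable_fun setT (F n) by exact: measurable_funeM.
apply: (@le_trans _ _ (\int[gamma]_(y in cube x h) \sum_(0 <= k <oo) F k y)).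
  apply: ae_ge0_le_integral => //.
  - by move=> y _; rewrite mule_ge0// inve_ge0 poweR_ge0.
  - exact: measurable_funTS.
  - by move=> y _; apply: nneseries_ge0.
  - by apply: measurable_funTS; apply: ge0_emeasurable_sum.
  exists [set x]; split => //.
  - by rewrite -cube0; exact: measurable_cube.
  - exact: gaussian_set1.
  - move=> y /= hy; apply: contrapT => yx; apply: hy => xy.
    exact: kernel_domination.
rewrite integral_nneseries//; last by move=> n; exact: measurable_funTS.
apply: lee_nneseries => k _.
  by move=> _; apply: integral_ge0 => y _; exact: F0.
rewrite /F ge0_integralZl//; last 2 first.
- exact: measurable_funTS.
- by rewrite lee_fin powR_ge0.
rewrite lee_wpmul2l ?lee_fin ?powR_ge0//.
rewrite [leRHS]integral_mkcond [leLHS]integral_mkcond.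
apply: ge0_le_integral => //.
- by move=> y _; rewrite patchE; case: ifP => // _; rewrite lee_fin mulr_ge0.
- by apply/(measurable_restrictT _ _).1 => //; exact: measurable_funTS.
- apply/(measurable_restrictT _ _).1 => //; apply: measurable_funTS.
  by apply/measurable_EFinP; exact: measurableT_comp.
move=> y _; rewrite !patchE indicE.
have f0 : (0 <= `|f y|)%R by [].
by case: (y \in cube x h); case: (y \in cube x _) => /=;
  rewrite ?mulr1 ?mulr0 lee_fin.
Qed.

End domination.

(** * Integrals over unions *)

Section integration_lemmas.
Context dd (T : measurableType dd) (R : realType) (mu : {measure set T -> \bar R}).
Local Open Scope ereal_scope.
Implicit Types (A B S : set T) (g : T -> \bar R).

Lemma nneseries_le_bound (w : (\bar R)^nat) (M : \bar R) : (forall n, 0 <= w n) ->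
  (forall n, \sum_(0 <= k < n) w k <= M) -> \sum_(0 <= k <oo) w k <= M.
Proof.
move=> w0 wM; apply: lime_le.
  by apply: is_cvg_nneseries => n _ _; exact: w0.
by near=> n; exact: wM.
Unshelve. all: by end_near. Qed.

Import HBNNSimple.

(** The integral of a nonnegative function is a supremum over the simple
    functions below it, hence monotone for arbitrary functions and sets. This
    handles the superlevel sets of the fractional integral as they are. *)
Lemma integral_le_funepos_superset S A g : S `<=` A ->
  \int[mu]_(x in S) g x <= \int[mu]_(x in A) g^\+ x.
Proof.
move=> SA; rewrite integralE.
apply: (@le_trans _ _ (\int[mu]_(x in S) g^\+ x)).
  by apply: geeDl; rewrite oppe_le0 integral_ge0.
rewrite !ge0_integralE//; apply: ge_ereal_sup => _ [h /= hS <-].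
apply: ereal_sup_ubound; exists h => //= x; apply: (le_trans (hS x)).
rewrite !patchE; case: ifPn => [xS|_].
  by rewrite mem_set//; apply: SA; rewrite inE in xS.
by case: ifP => // _; exact: funepos_ge0.
Qed.

Lemma ge0_integral_bigcup_le (F : (set T)^nat) g : (forall n, measurable (F n)) ->
  measurable_fun setT g -> (forall x, 0 <= g x) ->
  \int[mu]_(x in \bigcup_n F n) g x <= \sum_(0 <= n <oo) \int[mu]_(x in F n) g x.
Proof.
move=> mF mg g0; rewrite seqDU_bigcup_eq ge0_integral_bigcup//.
- apply: lee_nneseries => [n _ _|n _]; first exact: integral_ge0.
  apply: ge0_subset_integral => //; [exact: seqDU_measurable | exact: measurable_funTS |].
  exact: subset_seqDU.
- exact: seqDU_measurable.
- by apply: measurable_funTS.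
Qed.

Lemma ge0_integral_setU_le A B g : measurable A -> measurable B ->
  measurable_fun setT g -> (forall x, 0 <= g x) ->
  \int[mu]_(x in A `|` B) g x <= \int[mu]_(x in A) g x + \int[mu]_(x in B) g x.
Proof.
move=> mA mB mg g0.
have mBA : measurable (B `\` A) by exact: measurableD.
have -> : A `|` B = A `|` (B `\` A) by rewrite setDE setUIr setUCr setIT.
rewrite ge0_integral_setU//; last 2 first.
- exact: measurable_funTS.
- by rewrite disj_set2E setDIK.
rewrite leeD2l//; apply: ge0_subset_integral => //; exact: measurable_funTS.
Qed.

Lemma ge0_integral_bigsetU_le (I : Type) (s : seq I) (A : I -> set T) g :
  (forall i, measurable (A i)) -> measurable_fun setT g -> (forall x, 0 <= g x) ->
  \int[mu]_(x in \big[setU/set0]_(i <- s) A i) g x <=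
  \sum_(i <- s) \int[mu]_(x in A i) g x.
Proof.
move=> mA mg g0; elim: s => [|i s IH]; first by rewrite !big_nil integral_set0.
rewrite !big_cons (le_trans (ge0_integral_setU_le _ _ _ _))//.
  exact: bigsetU_measurable.
by rewrite leeD2l.
Qed.

Lemma powR_mul_pred (z r : R) : (1 <= r)%R -> (0 <= z)%R ->
  (z `^ (r - 1) * z = z `^ r)%R.
Proof.
move=> r1 z0; rewrite -{2}(powRr1 z0) -powRD ?subrK//.
by apply/implyP => /eqP; lra.
Qed.

Lemma powR_le_mul (z M r : R) : (1 <= r)%R -> (0 <= z)%R -> (z <= M)%R ->
  (z `^ r <= M `^ (r - 1) * z)%R.
Proof.
move=> r1 z0 zM; rewrite -powR_mul_pred// ler_wpM2r//.
apply: ge0_ler_powR; rewrite ?nnegrE//; first lra.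
exact: le_trans zM.
Qed.

(** As the exponent is at least 1 and each term [x] is at most [M], the total
    integral, [x^r <= M^(r-1) x]; the terms themselves add up to at most [M]. *)
Lemma sum_power_integral_disjoint (D : set nat) (P : (set T)^nat) g (r : R) :
  (1 <= r)%R -> (forall n, measurable (P n)) -> trivIset D P ->
  measurable_fun setT g -> (forall x, 0 <= g x) -> \int[mu]_x g x < +oo ->
  \sum_(0 <= n <oo) (\int[mu]_(x in if n \in D then P n else set0) g x) `^ r <=
  (\int[mu]_x g x) `^ r.
Proof.
move=> r1 mP tP mg g0 goo.
set P' := fun n => if n \in D then P n else set0.
have mP' n : measurable (P' n) by rewrite /P'; case: ifP.
have tP' : trivIset setT P' by rewrite /P' -trivIset_mkcond.
set M := \int[mu]_x g x in goo *.
have M0 : 0 <= M by exact: integral_ge0.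
have Mfin : M \is a fin_num by rewrite ge0_fin_numE.
pose X n := \int[mu]_(x in P' n) g x.
have X0 n : 0 <= X n by exact: integral_ge0.
have XM n : X n <= M by apply: ge0_subset_integral.
have split_power (z : \bar R) : 0 <= z -> z <= M -> z `^ r <= M `^ (r - 1) * z.
  move=> z0 zM.
  have zfin : z \is a fin_num by rewrite ge0_fin_numE// (le_lt_trans zM).
  have fz0 : (0 <= fine z)%R by exact: fine_ge0.
  have fzM : (fine z <= fine M)%R by exact: fine_le.
  have := powR_le_mul r1 fz0 fzM.
  by rewrite -lee_fin EFinM -!poweR_EFin !fineK.
have Mr : M `^ (r - 1) * M <= M `^ r.
  rewrite -(fineK Mfin) !poweR_EFin -EFinM lee_fin powR_mul_pred// fine_ge0//.
apply: le_trans Mr.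
have Mrfin : M `^ (r - 1) \is a fin_num by rewrite fin_num_poweR.
apply: (@le_trans _ _ (\sum_(0 <= n <oo) (fine (M `^ (r - 1)))%:E * X n)).
  apply: lee_nneseries => [n _ _|n _]; first exact: poweR_ge0.
  rewrite fineK//; exact: split_power (X0 n) (XM n).
rewrite nneseriesZl//.
rewrite fineK// lee_wpmul2l ?poweR_ge0//.
rewrite -ge0_integral_bigcup//; last exact: measurable_funTS.
apply: ge0_subset_integral => //; exact: bigcup_measurable.
Qed.

Lemma ge0_integral_disjoint_power_le (I : finType) (D B : I -> set nat)
    (P : I -> (set T)^nat) (u g : T -> \bar R) (r kappa : R) :
  (1 <= r)%R -> (0 <= kappa)%R -> (forall i n, measurable (P i n)) ->
  (forall i, trivIset (D i) (P i)) -> (forall i, B i `<=` D i) ->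
  measurable_fun setT u -> (forall x, 0 <= u x) ->
  measurable_fun setT g -> (forall x, 0 <= g x) -> \int[mu]_x g x < +oo ->
  (forall i n, B i n ->
     \int[mu]_(x in P i n) u x <= kappa%:E * (\int[mu]_(x in P i n) g x) `^ r) ->
  \int[mu]_(x in \big[setU/set0]_(i : I) \bigcup_(n in B i) P i n) u x <=
  (#|I|%:R * kappa)%:E * (\int[mu]_x g x) `^ r.
Proof.
move=> r1 k0 mP tP BD mu0 u0 mg g0 goo H.
apply: (le_trans (ge0_integral_bigsetU_le _ _ _ _)) => //.
  by move=> i; exact: bigcup_measurable.
have -> : (#|I|%:R * kappa)%:E * (\int[mu]_x g x) `^ r =
    \sum_(i : I) (kappa%:E * (\int[mu]_x g x) `^ r).
  by rewrite sumr_const EFinM -muleA mule_natl.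
apply: lee_sum => i _.
rewrite bigcup_mkcond.
apply: (le_trans (ge0_integral_bigcup_le _ _ _)) => //.
  by move=> n; case: ifP.
apply: le_trans (lee_wpmul2l _ (sum_power_integral_disjoint r1 (mP i) (tP i) mg g0 goo));
  last by rewrite lee_fin.
rewrite -nneseriesZl; last by move=> n _; exact: poweR_ge0.
apply: lee_nneseries => [n _ _|n _]; first exact: integral_ge0.
case: ifPn => [|_]; last first.
  by rewrite integral_set0 mule_ge0 ?lee_fin ?poweR_ge0.
rewrite inE => Bn; rewrite mem_set; last exact: BD.
exact: H.
Qed.

End integration_lemmas.

(** * Comparing the kernel with a covering cube, and geometric series *)

Section kernel_estimate.
Context {R : realType} {d : nat}.
Implicit Types (x y c : Rd R d) (a b t alpha beta : R).

(** By doubling, [gamma] of the small cube is comparable to [gamma(P)], where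
    [P] is the large cube; then
    [gamma(P)^(alpha/d - 1) = gamma(P)^((alpha - beta)/d) gamma(P)^(beta/d - 1)]
    and [gamma(P)] is at most the Lebesgue measure [(t b)^d]. The gain
    [t^(alpha - beta)] is what makes the sum over the scales converge. *)
Lemma kernel_le_cube a b alpha beta : 0 < a -> 0 < b -> (0 < d)%N ->
  alpha < d%:R -> beta < alpha ->
  exists C : R, 0 < C /\ forall t x c, 0 < t -> t <= 1 ->
    cube x (t * a * mfunction x) `<=` cube c (t * b * mfunction c) ->
    gcube x (t * (a * mfunction x) / 4) `^ (- (1 - alpha / d%:R)) <=
    C * t `^ (alpha - beta) *
      gcube c (t * b * mfunction c) `^ (beta / d%:R - 1).
Proof.
move=> a0 b0 d0 ad ba.
have dR0 : 0 < d%:R :> R by rewrite ltr0n.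
pose s := 1 - alpha / d%:R.
have s0 : 0 < s by rewrite subr_gt0 ltr_pdivrMr// mul1r.
(* bound for the ratio between the sides of the large and of the small cube *)
pose k := 4 * b * (1 + d%:R * b) / a.
have k0 : 0 < k by rewrite divr_gt0// !mulr_gt0// ltr_wpDr// mulr_ge0// ltW.
pose D := @density_oscillation R d b ^+ 2 * k ^+ d.
have D0 : 0 < D by rewrite mulr_gt0 ?exprn_gt0// expR_gt0.
exists (D `^ s * b `^ (alpha - beta)); split; first by rewrite mulr_gt0 ?powR_gt0.
move=> t x c t0 t1 sub; rewrite -/s.
have mx0 := mfunction_gt0 x; have mc0 := mfunction_gt0 c.
have mc1 := mfunction_le1 c.
set r := t * (a * mfunction x) / 4; set L := t * b * mfunction c in sub *.
have r0 : 0 < r by rewrite !mulr_gt0.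
have L0 : 0 < L by rewrite !mulr_gt0.
have xx : cube x (t * a * mfunction x) x by apply: cube_center; rewrite !mulr_ge0// ltW.
have [h1 h2] := mfunction_comparable b0 t0 t1 (sub _ xx).
have mcx : mfunction c <= (1 + d%:R * b) * mfunction x.
  by rewrite !mfunctionE ler_pdivlMr ?inv_mfunction_gt0// ler_pdivrMl ?inv_mfunction_gt0// mulrC.
have Lkr : L <= k * r.
  have -> : k * r = t * b * ((1 + d%:R * b) * mfunction x).
    by rewrite /k /r; field; rewrite gt_eqF.
  by rewrite ler_pM2l// mulr_gt0.
have subr : cube x r `<=` cube c L.
  apply: subset_trans sub; apply: sub_cube.
  have tam : 0 < t * (a * mfunction x) by rewrite !mulr_gt0.
  by rewrite /r ler_pdivrMr// -mulrA; lra.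
have := gaussian_cube_doubling b0 t0 t1 r0 Lkr subr.
rewrite -/L -/D !gcubeE -EFinM lee_fin => gD.
have gLb : gcube c L <= (t * b) ^+ d.
  rewrite -lee_fin -gcubeE; apply: (le_trans (gaussian_cube_le _ (ltW L0))).
  rewrite lee_fin lerXn2r ?nnegrE ?(ltW L0) ?mulr_ge0 ?(ltW t0) ?(ltW b0)//.
  by rewrite /L ler_piMr// mulr_ge0// ltW.
have g0 := gcube_gt0 x r0; have G0 := gcube_gt0 c L0.
move: gD gLb g0 G0; move: (gcube x r) (gcube c L) => g G gD gLb g0 G0.
have e1 : g `^ (- s) <= D `^ s * G `^ (- s).
  rewrite !powRN ler_pdivlMr ?powR_gt0// mulrC -ler_pdivlMr ?invr_gt0 ?powR_gt0//.
  rewrite invrK -powRM ?(ltW D0) ?(ltW g0)//.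
  apply: ge0_ler_powR => //; rewrite ?nnegrE ?(ltW s0) ?(ltW G0)//.
  by rewrite mulr_ge0// ltW.
apply: (le_trans e1); rewrite -!mulrA ler_wpM2l ?powR_ge0//.
have -> : - s = (alpha - beta) / d%:R + (beta / d%:R - 1).
  by rewrite /s; field; rewrite gt_eqF.
rewrite (@powRD _ G ((alpha - beta) / d%:R)); last by rewrite (gt_eqF G0) implybT.
rewrite mulrA ler_wpM2r ?powR_ge0//.
rewrite -powRM ?(ltW b0) ?(ltW t0)// (mulrC b).
have ab0 : 0 <= (alpha - beta) / d%:R by rewrite divr_ge0 ?(ltW dR0)// subr_ge0 ltW.
have tb0 : 0 <= t * b by rewrite mulr_ge0// ltW.
apply: (@le_trans _ _ (((t * b) ^+ d) `^ ((alpha - beta) / d%:R))).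
  by apply: ge0_ler_powR => //; rewrite ?nnegrE ?(ltW G0) ?exprn_ge0.
rewrite -powR_mulrn// -powRrM mulrCA divff ?mulr1// gt_eqF//.
Qed.

End kernel_estimate.

Section weak_type.
Context {R : realType} {d : nat}.
Implicit Types (x y c : Rd R d) (u v f : Rd R d -> R).
Local Notation gamma := (@gaussian R d).
Local Open Scope ereal_scope.

Lemma weak_type_of_product (q p K m : R) (w U F G : \bar R) : (0 < q)%R ->
  (0 < K)%R -> (0 < m)%R -> 0 <= U -> 0 <= G ->
  m%:E < w * F -> w * U `^ q^-1 * F <= K%:E * G `^ p^-1 ->
  U <= ((K / m) `^ q)%:E * G `^ (q / p).
Proof.
move=> q0 K0 m0 U0 G0 mF H.
have e1 : m%:E * U `^ q^-1 <= K%:E * G `^ p^-1.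
  apply: le_trans H; rewrite muleAC lee_wpmul2r ?poweR_ge0//; exact: ltW.
have e2 : U `^ q^-1 <= (K / m)%:E * G `^ p^-1.
  by rewrite (_ : (K / m)%:E = m^-1%:E * K%:E); [rewrite -muleA lee_pdivlMl|rewrite -EFinM mulrC].
have e3 : (U `^ q^-1) `^ q <= ((K / m)%:E * G `^ p^-1) `^ q.
  apply: gt0_ler_poweR; rewrite ?(ltW q0)// ?in_itv/= ?leey ?andbT ?poweR_ge0//.
  by rewrite mule_ge0 ?poweR_ge0// lee_fin divr_ge0// ltW.
move: e3; rewrite -poweRrM mulVf ?gt_eqF// poweRe1// poweRM ?poweR_ge0//; last first.
  by rewrite lee_fin divr_ge0// ltW.
by rewrite poweR_EFin -poweRrM (mulrC p^-1)%R.
Qed.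


(** The thresholds add up to [lambda]. *)
Lemma geometric_pigeonhole (A : (\bar R)^nat) (theta lambda : R) :
  (0 < theta)%R -> (theta < 1)%R -> (0 < lambda)%R -> (forall k, 0 <= A k) ->
  lambda%:E < \sum_(0 <= k <oo) A k ->
  exists k, ((1 - theta) * lambda * theta ^+ k)%:E < A k.
Proof.
move=> t0 t1 l0 A0; rewrite ltNge => /negP H; apply/not_existsP => Hk; apply: H.
apply: nneseries_le_bound => // n.
apply: (@le_trans _ _ (\sum_(0 <= k < n) ((1 - theta) * lambda * theta ^+ k)%:E)).
  by apply: lee_sum => k _; have /negP := Hk k; rewrite -leNgt.
rewrite sumEFin lee_fin -mulr_sumr big_mkord mulrAC.
have -> : ((1 - theta) * \sum_(i < n) theta ^+ i = 1 - theta ^+ n)%R.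
  by rewrite -[RHS]opprB subrX1 -mulNr opprB.
by rewrite ler_piMl ?(ltW l0)// gerBl exprn_ge0// ltW.
Qed.

Lemma geometric_series_le (rho : R) (B : \bar R) : (0 < rho)%R -> (rho < 1)%R ->
  0 <= B -> \sum_(0 <= k <oo) ((rho ^+ k)%:E * B) <= ((1 - rho)^-1)%:E * B.
Proof.
move=> r0 r1 B0; apply: nneseries_le_bound => [n|n].
  by rewrite mule_ge0// lee_fin exprn_ge0// ltW.
rewrite -ge0_sume_distrl; last by move=> i _; rewrite lee_fin exprn_ge0// ltW.
rewrite lee_wpmul2r// sumEFin lee_fin big_mkord -[leRHS]mul1r ler_pdivlMr ?subr_gt0//.
rewrite mulrC.
have -> : ((1 - rho) * \sum_(i < n) rho ^+ i = 1 - rho ^+ n)%R.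
  by rewrite -[RHS]opprB subrX1 -mulNr opprB.
by rewrite gerBl exprn_ge0// ltW.
Qed.

End weak_type.

(** * The weak type inequality *)

Section weak_type_bound.
Context {R : realType} {d : nat}.
Implicit Types (x y c : Rd R d) (u v f : Rd R d -> R).
Local Notation gamma := (@gaussian R d).
Local Open Scope ereal_scope.

Lemma powRXn (w e : R) (k : nat) : (0 <= w)%R ->
  ((w ^+ k) `^ e = (w `^ e) ^+ k)%R.
Proof.
by move=> w0; rewrite -(powR_mulrn k w0) -powRrM mulrC powRrM powR_mulrn ?powR_ge0.
Qed.

Lemma powRV (w e : R) : (0 <= w)%R -> (w^-1 `^ e = (w `^ e)^-1)%R.
Proof.
by move=> w0; rewrite -(powR_inv1 w0) -powRrM mulrC powRrM powR_inv1 ?powR_ge0.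
Qed.

Lemma powR_dyadic (k : nat) (e : R) :
  ((2^-1 ^+ k) `^ e = (2^-1 `^ (e / 2)) ^+ k * (2^-1 `^ (e / 2)) ^+ k :> R)%R.
Proof.
have h0 : (0 <= 2^-1 :> R)%R by [].
rewrite -exprMn -powRD; last by rewrite invr_eq0 pnatr_eq0 implybT.
by rewrite -splitr powRXn.
Qed.

(** A point where the fractional integral exceeds [lambda] lies in a covering
    cube, of some scale [2^-k], whose fractional average exceeds a threshold
    growing like [theta^-k]: half of the gain [theta^(2 k)] of scale [k] pays
    for splitting [lambda] over the scales, the other half makes the threshold
    grow. *)
Lemma frac_integral_large_cube (a b alpha beta C lambda theta : R) (I : Type)
    (c : nat -> I -> nat -> Rd R d) (D : nat -> I -> set nat) f x :
  (0 < a)%R -> (0 < alpha)%R -> (alpha < d%:R)%R -> (0 < C)%R -> (0 < lambda)%R ->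
  theta = (2^-1 `^ ((alpha - beta) / 2))%R -> (0 < theta)%R -> (theta < 1)%R ->
  (forall t x c, (0 < t)%R -> (t <= 1)%R ->
    cube x (t * a * mfunction x) `<=` cube c (t * b * mfunction c) ->
    gcube x (t * (a * mfunction x) / 4) `^ (- (1 - alpha / d%:R)) <=
    C * t `^ (alpha - beta) *
      gcube c (t * b * mfunction c) `^ (beta / d%:R - 1))%R ->
  (forall k x, exists i n, D k i n /\ cube x (2^-1 ^+ k * a * mfunction x) `<=`
     cube (c k i n) (2^-1 ^+ k * b * mfunction (c k i n))) ->
  measurable_fun setT f ->
  lambda%:E < local_frac_integral a alpha f x ->
  exists k i n, let P := cube (c k i n) (2^-1 ^+ k * b * mfunction (c k i n)) in
    [/\ D k i n, P x & ((1 - theta) * lambda / (C * theta ^+ k))%:E <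
       gamma P `^ (beta / d%:R - 1) * \int[gamma]_(y in P) `|f y|%:E].
Proof.
move=> a0 al0 ald C0 l0 thetaE th0 th1 HC cov mf Hx.
have d0 : (0 < d)%N by rewrite -(ltr0n R) (lt_trans al0).
have dR0 : (0 < d%:R :> R)%R by rewrite ltr0n.
have s0 : (0 < 1 - alpha / d%:R)%R by rewrite subr_gt0 ltr_pdivrMr// mul1r.
have h0 : (0 < a * mfunction x)%R by rewrite mulr_gt0// mfunction_gt0.
have := local_frac_integral_lt mf Hx.
under eq_integral do rewrite abse_frac_integrand.
move=> {}Hx.
have mker : measurable_fun setT
    (fun y => `|f y|%:E * (gamma (cube x (enorm (subRd x y))) `^ (1 - alpha / d%:R))^-1).
  under eq_fun do rewrite -abse_frac_integrand.
  by apply: measurableT_comp => //; exact: measurable_frac_integrand.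
have := lt_le_trans Hx (frac_integral_domination d0 s0 h0 mf mker).
move=> /geometric_pigeonhole-/(_ _ th0 th1 l0)[|k Hk].
  by move=> k; rewrite mule_ge0 ?lee_fin ?powR_ge0// integral_ge0.
have t0 : (0 < 2^-1 ^+ k :> R)%R by rewrite exprn_gt0.
have t1 : (2^-1 ^+ k <= 1 :> R)%R by rewrite exprn_ile1// invf_le1// ler1n.
have [i [n [Dn sub]]] := cov k x.
exists k, i, n; set P := cube _ _ => /=; split => //.
  by apply: sub; apply: cube_center; rewrite -mulrA mulr_ge0// ltW.
have Hker := HC _ _ _ t0 t1 sub.
have tk0 : (0 < theta ^+ k)%R by rewrite exprn_gt0.
rewrite powR_dyadic -thetaE in Hker.
have mP : measurable P by exact: measurable_cube.
have Fsub : \int[gamma]_(y in cube x (2^-1 ^+ k * (a * mfunction x))) `|f y|%:E <=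
    \int[gamma]_(y in P) `|f y|%:E.
  apply: ge0_subset_integral => //.
  - exact: measurable_cube.
  - apply/measurable_EFinP; apply: measurable_funTS.
    exact: measurableT_comp.
  - by rewrite mulrA.
have int0 Q : 0 <= \int[gamma]_(y in Q) `|f y|%:E.
  by apply: integral_ge0 => y _; rewrite lee_fin.
have {}Hk := lt_le_trans Hk (lee_pmul (powR_ge0 _ _ : 0 <= (_ `^ _)%R%:E) (int0 _)
  (Hker : _%:E <= _%:E) Fsub).
rewrite gcubeE poweR_EFin.
have Ct : (0 < C * (theta ^+ k * theta ^+ k))%R by rewrite !mulr_gt0.
rewrite -(@lte_pmul2l _ (C * (theta ^+ k * theta ^+ k))%:E)//.
rewrite muleA -!EFinM.
have -> : (C * (theta ^+ k * theta ^+ k) * ((1 - theta) * lambda / (C * theta ^+ k)) =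
    (1 - theta) * lambda * theta ^+ k)%R by field; rewrite !gt_eqF.
exact: Hk.
Qed.

Lemma pos_part_funepos u x : (EFin \o u)^\+ x = (u^\+ x)%R%:E.
Proof. by rewrite funeposE /funrpos /= EFin_max. Qed.

End weak_type_bound.

Theorem theorem1p4 (R : realType) (d : nat) (a p q alpha : R)
    (u v : Rd R d -> R)
    (ha : 0 < a) (hp : 1 <= p) (hpq : p <= q)
    (halpha : 0 < alpha) (halphad : alpha < d%:R)
    (hu : weight u) (hv : weight v)
    (huv : (\bigcup_(b' in [set b' : R | a < b'])
             \bigcup_(beta' in [set beta' : R | 0 < beta' < alpha])
               muckenhoupt p q beta' b') (u, v)) :
  exists C : R, 0 < C /\
    forall f : Rd R d -> R, in_Lp p v f ->
    forall lambda : R, 0 < lambda ->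
      (\int[@gaussian R d]_(x in
            [set x | (lambda%:E < local_frac_integral a alpha f x)%E])
          (u x)%:E
       <= (C / lambda `^ q)%:E
          * (\int[@gaussian R d]_x (`|f x| `^ p * v x)%:E) `^ (q / p))%E.
Proof.
case: huv => b ab [beta /andP[beta0 balpha]] muck.
rewrite /= in ab.
have b0 : 0 < b by exact: lt_trans ab.
have p0 : 0 < p by exact: lt_le_trans hp.
have q0 : 0 < q by exact: lt_le_trans hpq.
have r1 : 1 <= q / p by rewrite ler_pdivlMr// mul1r.
have d0 : (0 < d)%N by rewrite -(ltr0n R) (lt_trans halpha).
have [K [K0 HK]] := muckenhoupt_cube hp q0 hu hv muck.
have [C [C0 HC]] := kernel_le_cube ha b0 d0 halphad balpha.
have [I cov] := @local_cube_covering R d a b ha ab.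
have tk0 k : 0 < 2^-1 ^+ k :> R by rewrite exprn_gt0.
have tk1 k : 2^-1 ^+ k <= 1 :> R by rewrite exprn_ile1// invf_le1// ler1n.
have /choice[c /choice[D HcD]] k := cov _ (tk0 k) (tk1 k).
pose theta : R := 2^-1 `^ ((alpha - beta) / 2).
have pow1 (e : R) : 1 `^ e = 1 :> R by rewrite powR1.
have e0 : 0 < (alpha - beta) / 2 by rewrite divr_gt0// subr_gt0.
have th0 : 0 < theta by rewrite powR_gt0.
have th1 : theta < 1.
  by rewrite -(pow1 ((alpha - beta) / 2)) gt0_ltr_powR ?nnegrE// invf_lt1// ltr1n.
pose rho := theta `^ q.
have rho0 : 0 < rho by rewrite powR_gt0.
have rho1 : rho < 1.
  by rewrite -(pow1 q) gt0_ltr_powR ?nnegrE// ltW.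
pose C1 := (K * C / (1 - theta)) `^ q.
have C10 : 0 <= C1 by exact: powR_ge0.
exists (#|I|%:R * C1 / (1 - rho) + 1); split.
  by rewrite ltr_wpDl// divr_ge0 ?mulr_ge0// subr_ge0 ltW.
move=> f [mf fLp] lambda l0.
have [[mu _] u0] := hu; have [[mv _] v0] := hv.
have mup := measurable_funrpos mu; have mvp := measurable_funrpos mv.
(* agrees almost everywhere with the integrand of the norm of f, and is
   nonnegative everywhere *)
pose g (x : Rd R d) : \bar R := (`|f x| `^ p * v^\+ x)%:E.
have mfp : measurable_fun setT (fun x => `|f x| `^ p).
  by apply: (measurableT_comp (measurable_powR _)); exact: measurableT_comp.
have mg : measurable_fun setT g.
  by apply/measurable_EFinP; exact: measurable_funM.
have g0 x : (0 <= g x)%E by rewrite lee_fin mulr_ge0 ?powR_ge0// funrpos_ge0.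
have intg : (\int[@gaussian R d]_x (`|f x| `^ p * v x)%:E =
    \int[@gaussian R d]_x g x)%E.
  apply: ae_eq_integral_gaussian => //.
  - by apply/measurable_EFinP; exact: measurable_funM.
  - by apply: filterS (ae_eq_pos_part v0) => x vx; rewrite /g -vx.
rewrite intg in fLp *.
set M := (\int[_]_x g x)%E in fLp *.
pose P k i n := cube (c k i n) (2^-1 ^+ k * b * mfunction (c k i n)).
have mP k i n : measurable (P k i n) by exact: measurable_cube.
pose m k := (1 - theta) * lambda / (C * theta ^+ k).
have m0 k : 0 < m k by rewrite divr_gt0// mulr_gt0// ?subr_gt0// exprn_gt0.
pose B k i := [set n | D k i n /\ ((m k)%:E <
   @gaussian R d (P k i n) `^ (beta / d%:R - 1) *
   \int[@gaussian R d]_(y in P k i n) `|f y|%:E)%E].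
pose E := \bigcup_k \big[setU/set0]_(i : I) \bigcup_(n in B k i) P k i n.
have SE : [set x | (lambda%:E < local_frac_integral a alpha f x)%E] `<=` E.
  move=> x /=; move/(frac_integral_large_cube (c := c) (D := D) ha halpha
    halphad C0 l0 erefl th0 th1 HC (fun k => (HcD k).1) mf).
  move=> [k [i [n [Dn Px mlt]]]]; exists k => //.
  rewrite -bigcup_seq; exists i; first by rewrite /= mem_index_enum.
  by exists n.
have mupE : measurable_fun setT (fun x => (u^\+ x)%:E) by exact/measurable_EFinP.
have up0 x : (0 <= (u^\+ x)%:E)%E by rewrite lee_fin funrpos_ge0.
apply: (le_trans (integral_le_funepos_superset _ _ SE)).
under eq_integral do rewrite (pos_part_funepos u).
apply: (le_trans (ge0_integral_bigcup_le _ _ _ _)) => //.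
  by move=> k; apply: bigsetU_measurable => i _; exact: bigcup_measurable.
pose B0 : \bar R := ((#|I|%:R * (C1 / lambda `^ q))%:E * M `^ (q / p))%E.
have B00 : (0 <= B0)%E.
  by rewrite mule_ge0 ?poweR_ge0// lee_fin mulr_ge0// divr_ge0// powR_ge0.
apply: (@le_trans _ _ (\sum_(0 <= k <oo) ((rho ^+ k)%:E * B0))%E).
  apply: lee_nneseries => [k _ _|k _]; first exact: integral_ge0.
  have -> : ((rho ^+ k)%:E * B0 =
      (#|I|%:R * ((K / m k) `^ q))%:E * M `^ (q / p))%E.
    rewrite /B0 muleA -EFinM; congr (_%:E * _)%E.
    rewrite mulrCA; congr (_ * _).
    have -> : K / m k = theta ^+ k * (K * C / (1 - theta)) / lambda.
      by rewrite /m; field; rewrite !gt_eqF ?subr_gt0// exprn_gt0.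
    have KC0 : 0 <= K * C / (1 - theta).
      by rewrite divr_ge0 ?mulr_ge0// ?(ltW K0) ?(ltW C0)// subr_ge0 ltW.
    have tk : 0 <= theta ^+ k by rewrite exprn_ge0// ltW.
    rewrite /C1; move: (K * C / (1 - theta)) KC0 => X X0.
    rewrite (@powRM _ (theta ^+ k * X)) ?invr_ge0 ?mulr_ge0 ?(ltW l0)//.
    rewrite (@powRM _ (theta ^+ k))// -mulrA; congr (_ * (_ * _)).
      exact/esym/powRXn/ltW.
    exact/esym/powRV/ltW.
  apply: (ge0_integral_disjoint_power_le (D := D k) (g := g)) => //.
  - exact: powR_ge0.
  - exact: (HcD k).2.
  - by move=> i n [].
  move=> i n [Dn mlt].
  have aP : admissible_cubes b (P k i n).
    have mc := mfunction_gt0 (c k i n).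
    exists (c k i n), (2^-1 ^+ k * b * mfunction (c k i n)); split => //.
      by apply: mulr_gt0 => //; apply: mulr_gt0.
    by rewrite ler_pM2r// ler_piMl// ltW.
  apply: (weak_type_of_product q0 K0 (m0 k) _ _ mlt (HK _ aP f mf)).
  - exact: integral_ge0.
  - by apply: integral_ge0 => x _; exact: g0.
apply: (le_trans (geometric_series_le rho0 rho1 B00)).
rewrite /B0 muleA lee_wpmul2r ?poweR_ge0// -EFinM lee_fin.
have L0 : 0 < lambda `^ q by exact: powR_gt0.
have -> : (1 - rho)^-1 * (#|I|%:R * (C1 / lambda `^ q)) =
    #|I|%:R * C1 / (1 - rho) / lambda `^ q by ring.
by rewrite ler_pM2r ?invr_gt0// lerDl.
Qed.
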